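(* Let $q$ be a prime power and let $n$ be a positive integer. Let $r \in \mathbb{N}$ be a divisor of $q^n-1$ and let $f \in \mathbb{F}_q[x]$ be a monic divisor of $x^n-1$ of degree $k$. Let $\ell$ be a (positive) divisor of $q^n-1$ and let $\{p_1,\ldots,p_v\}$ be the set of all primes which divide $q^n-1$ but do not divide $\ell$. Let $g \in \mathbb{F}_q[x]$ be a monic divisor of $x^n-1$ and let $\{P_1,\ldots,P_s\} \subset \mathbb{F}_q[x]$ be the set of all monic irreducible polynomials which divide $x^n-1$ but do not divide $g$, ordered so that $\{P_1,\ldots,P_{s'}\}$ is the subset of those which divide $\frac{x^n-1}{f}$. Suppose that $$\delta = 1-\sum_{i=1}^{v}\frac{1}{p_i}-\sum_{i=1}^{s}\frac{1}{q^{\deg P_i}}>0,$$ and let $$\delta' = 1-\sum_{i=s'+1}^{s}\frac{1}{q^{\deg P_i}} \quad\text{and}\quad \Delta = 2+\frac{v+s'-\delta'}{\delta}.$$ If $$q^{\frac{n}{2}-k} \geq r\, W(\ell)\, W\!\left(\gcd\left(g,\frac{x^n-1}{f}\right)\right)\Delta,$$ then $N_{r,f}(q^n-1,x^n-1)>0$.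
   Context: For a positive integer $t$, $W(t)$ is the number of square-free (positive) divisors of $t$; for a monic polynomial $t\in\mathbb{F}_q[x]$, $W(t)$ is the number of monic square-free divisors of $t$ in $\mathbb{F}_q[x]$. $\mathbb{F}_{q^n}$ is an $\mathbb{F}_q[x]$-module via $h\circ\alpha=\sum_i a_i\alpha^{q^i}$ for $h=\sum_i a_ix^i\in\mathbb{F}_q[x]$ and $\alpha\in\mathbb{F}_{q^n}$. For a divisor $m$ of $q^n-1$, an element $\alpha\in\mathbb{F}_{q^n}^*$ is $m$-free if for every $d\mid m$ with $d\neq 1$ there is no $\beta\in\mathbb{F}_{q^n}$ with $\alpha=\beta^d$. For a divisor $g\in\mathbb{F}_q[x]$ of $x^n-1$, an element $\alpha\in\mathbb{F}_{q^n}$ is $g$-free if for every monic $h\in\mathbb{F}_q[x]$ with $h\mid g$ and $h\neq 1$ there is no $\beta\in\mathbb{F}_{q^n}$ with $\alpha=h\circ\beta$. For monic divisors $f,g\in\mathbb{F}_q[x]$ of $x^n-1$ and divisors $m,r$ of $q^n-1$, define $$N_{r,f}(m,g)=\sum_{\alpha\in\mathbb{F}_{q^n}^*}\sum_{\beta\in\mathbb{F}_{q^n}}w_m(\alpha)\,\Omega_g(\beta)\,I_0(\alpha^r-f\circ\beta),$$ where $w_m(\alpha)$ is $1$ if $\alpha$ is $m$-free and $0$ otherwise, $\Omega_g(\beta)$ is $1$ if $\beta$ is $g$-free and $0$ otherwise, and $I_0(\gamma)$ is $1$ if $\gamma=0$ and $0$ otherwise. That is, $N_{r,f}(m,g)$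 is the number of pairs $(\alpha,\beta)\in\mathbb{F}_{q^n}^*\times\mathbb{F}_{q^n}$ such that $\alpha$ is $m$-free, $\beta$ is $g$-free and $\alpha^r=f\circ\beta$. *)

(* Defs.v *)
From mathcomp Require Import all_boot all_order all_algebra all_field.
From mathcomp Require Import boolp reals exp.

Set Implicit Arguments.
Unset Strict Implicit.
Unset Printing Implicit Defensive.

Import GRing.Theory.
Local Open Scope ring_scope.

Definition squarefree_nat (d : nat) : Prop :=
  forall e : nat, (e ^ 2 %| d)%N -> e = 1%N.

Definition W_nat (t : nat) : nat :=
  count (fun d => `[< squarefree_nat d >]) (divisors t).

Definition squarefree_poly (F : fieldType) (h : {poly F}) : Prop :=
  forall u : {poly F}, u ^+ 2 %| h -> size u = 1%N.

(* For t != 0 every divisor of t has size at most [size t], so ranging over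
   the finite type {poly_(size t) F} loses nothing.  The value depends on t
   only up to a nonzero scalar, so it may be applied to [gcdp], which is not
   normalised to be monic. *)
Definition W_poly (F : finFieldType) (t : {poly F}) : nat :=
  #|[set h : {poly_(size t) F} |
      [&& (h : {poly F}) \is monic, (h : {poly F}) %| t
        & `[< squarefree_poly (h : {poly F}) >] ]]|.

(* The F[x]-module structure of L in which x acts as the q-Frobenius,
   q = #|F|. *)
Definition poly_act (F : finFieldType) (L : fieldExtType F)
    (h : {poly F}) (a : L) : L :=
  \sum_(i < size h) h`_i *: a ^+ (#|F| ^ i)%N.

Definition m_free (L : fieldType) (m : nat) (a : L) : Prop :=
  forall d : nat, (d %| m)%N -> d <> 1%N -> ~ exists b : L, a = b ^+ d.

Definition g_free (F : finFieldType) (L : fieldExtType F)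
    (g : {poly F}) (a : L) : Prop :=
  forall h : {poly F}, h \is monic -> h %| g -> h <> 1 ->
    ~ exists b : L, a = poly_act h b.

Definition w_ind (L : fieldType) (m : nat) (a : L) : nat :=
  if `[< m_free m a >] then 1%N else 0%N.

Definition Omega_ind (F : finFieldType) (L : fieldExtType F)
    (g : {poly F}) (b : L) : nat :=
  if `[< g_free g b >] then 1%N else 0%N.

Definition I0_ind (L : fieldType) (c : L) : nat :=
  if c == 0 then 1%N else 0%N.

(* [finvect_type L] is L itself, equipped with its finite type structure. *)
Definition N_count (F : finFieldType) (L : fieldExtType F)
    (r : nat) (f : {poly F}) (m : nat) (g : {poly F}) : nat :=
  (\sum_(a : finvect_type L | a != 0%R) \sum_(b : finvect_type L)
     w_ind m (a : L) * Omega_ind g (b : L)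
       * I0_ind ((a : L) ^+ r - poly_act f (b : L))%R)%N.

(* Main.v *)
Require Import Defs.
From mathcomp Require Import all_boot all_order all_algebra all_field.
From mathcomp Require Import all_fingroup all_solvable all_character.
From mathcomp Require Import boolp reals exp.
From mathcomp Require Import ring.

(** Let K be the field with q^n elements and x = sqrt (q^n).  An element is
    m-free when it avoids the p-th powers for all primes p dividing m, and g-free
    when it avoids the images of the actions of all monic irreducible divisors P
    of g ([w_avoid], [Omega_avoid]).  So the count N is a sum over pairs (a, b)
    with a^r = f o b of products of indicator functions, that is, a correlation
    of a function u of a with the direct image under f of a function of b.

    Such a correlation is controlled by characters ([correlation_le]).  Expand u
    in multiplicative characters and the direct image in additive ones, with
    coefficients of absolute sum A and B.  The trivial additive character gives
    the expected main term, and a pair with a nontrivial one gives a sum of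
    eta(a) psi(y a^r) of modulus at most r x ([gauss_sum_le]).  The error is
    thus at most A B r x, less the share of the trivial character.

    It remains to bound A and B.  The indicator of a subgroup has nonnegative
    coefficients adding up to 1, so passing from a subgroup to the complement in
    it of a smaller one costs a factor 2 (1 - 1/index)
    ([ind_diff_fourier_le], [pow_free_fourier_le]).  This yields
    A <= theta 2^(number of primes dividing l), where theta is the density of
    the l-free elements.  For B write X^n - 1 = f f'.  The kernel of
    f is the image of f', because kernels have the expected number of elements
    ([act_im_ker], [card_act_ker]).  An irreducible P dividing f' has an image
    containing this kernel, and contributes a factor 2 (1 - q^(- deg P)); any
    other P is equidistributed on the cosets of the kernel and contributes only
    its density 1 - q^(- deg P) ([push_avoid], [push_avoid_le]).  Therefore B is
    at most the density of the g-free elements times q^k 2^m, where m counts the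
    irreducible divisors of gcd (g, f').  These powers of 2 are at most the
    numbers W of squarefree divisors ([W_nat_ge], [W_poly_ge]).

    Finally the primes p_i and the P_i are sieved out with weights centred at
    their densities ([sieve_positive]): the pairs free for l and g, multiplied by
    delta, give the main term, and the corrections at p_i and at P_i dividing f'
    are bounded by (1 - 1/p_i) and (1 - q^(- deg P_i)) times the error bound,
    while the P_i not dividing f' give no correction at all.  The total is
    positive as soon as x is at least q^k r W(l) W(gcd (g, f')) Delta.  Strict
    positivity for equality comes from the share of the trivial additive
    character.

    Characters take algebraic values, whereas the hypothesis is about real
    numbers; after squaring, the latter is an inequality between rationals
    ([sieve_bound_transfer]). *)

Set Implicit Arguments.
Unset Strict Implicit.
Unset Printing Implicit Defensive.

Import Order.TTheory GRing.Theory Num.Theory.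
Local Open Scope ring_scope.

(** * Functions with an absolutely bounded character expansion *)

Section FourierSums.

Variables (T : Type) (I : nmodType) (e : I -> T -> algC) (D : pred T).
Hypothesis eD : forall i j x, D x -> e (i + j) x = e i x * e j x.
Hypothesis e0 : forall x, D x -> e 0 x = 1.

(** The sequence [s] of pairs (coefficient, character index) expands [u] on [D].
    Indices may be repeated: no uniqueness of the coefficients is needed. *)
Definition fourier_sum (u : T -> algC) (s : seq (algC * I)) : Prop :=
  forall x, D x -> u x = \sum_(t <- s) t.1 * e t.2 x.

(** [u] has an expansion whose coefficients have absolute sum at most [A], that
    is, its Fourier algebra norm is at most [A]. *)
Definition fourier_le (u : T -> algC) (A : algC) : Prop :=
  exists2 s, fourier_sum u s & \sum_(t <- s) `|t.1| <= A.

Lemma fourier_le_ge0 u A : fourier_le u A -> 0 <= A.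
Proof. by case=> s _; apply: le_trans; apply: sumr_ge0 => t _. Qed.

Lemma fourier_le_ext u u' A :
  (forall x, D x -> u x = u' x) -> fourier_le u A -> fourier_le u' A.
Proof. by move=> uu' [s us sA]; exists s => // x Dx; rewrite -uu' ?us. Qed.

Lemma fourier_le_const c : fourier_le (fun=> c) `|c|.
Proof.
by exists [:: (c, 0)] => [x Dx|]; rewrite big_seq1 //= e0 // mulr1.
Qed.

Lemma fourier_leD u u' A A' : fourier_le u A -> fourier_le u' A' ->
  fourier_le (fun x => u x + u' x) (A + A').
Proof.
move=> [s us sA] [s' us' sA']; exists (s ++ s') => [x Dx|]; rewrite big_cat.
  by rewrite us ?us'.
exact: lerD.
Qed.

Lemma fourier_leM u u' A A' : fourier_le u A -> fourier_le u' A' ->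
  fourier_le (fun x => u x * u' x) (A * A').
Proof.
move=> [s us sA] [s' us' sA'].
exists [seq (t.1 * t'.1, t.2 + t'.2) | t <- s, t' <- s'] => [x Dx|].
  rewrite us // us' // big_allpairs_dep mulr_suml; apply: eq_bigr => t _.
  by rewrite mulr_sumr; apply: eq_bigr => t' _ /=; rewrite eD // mulrACA.
rewrite big_allpairs_dep /=.
rewrite (eq_bigr (fun t => `|t.1| * \sum_(t' <- s') `|t'.1|)).
  by rewrite -mulr_suml ler_pM ?sumr_ge0.
by move=> t _; rewrite mulr_sumr; apply: eq_bigr => t' _; rewrite normrM.
Qed.

Lemma fourier_leZ c u A : fourier_le u A ->
  fourier_le (fun x => c * u x) (`|c| * A).
Proof. exact/fourier_leM/fourier_le_const. Qed.

Lemma fourier_le_prod (J : eqType) (r : seq J) (u : J -> T -> algC) A :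
  (forall j, j \in r -> fourier_le (u j) (A j)) ->
  fourier_le (fun x => \prod_(j <- r) u j x) (\prod_(j <- r) A j).
Proof.
elim: r => [_|j r IHr uA].
  rewrite big_nil -[1]normr1.
  apply: fourier_le_ext (fourier_le_const 1) => x _; by rewrite big_nil normr1.
have uj := uA j (mem_head _ _).
have {}IHr := IHr (fun i ir => uA i (mem_behead (s := j :: r) ir)).
rewrite big_cons; apply: fourier_le_ext (fourier_leM uj IHr) => x _.
by rewrite big_cons.
Qed.

End FourierSums.

(** * Existence of additive and multiplicative characters *)

Section Characters.

Variable K : finFieldType.

Lemma exists_additive_character :
  exists psi : K -> algC, [/\ forall x y, psi (x + y) = psi x * psi y,
    forall x, `|psi x| = 1 & exists x, psi x != 1].
Proof.
have cKK : abelian [set: K] by apply/centsP => x _ y _; apply: addrC.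
have [i i_neq0] : exists i : Iirr [set: K], i != 0.
  have: (1 < Nirr [set: K])%N.
    move: cKK; rewrite card_classes_abelian => /eqP cK.
    by rewrite NirrE cK cardsT; apply: finNzRing_gt1.
  by move=> N1; exists (inord 1); rewrite -val_eqE /= inordK.
have lin_i : 'chi_i \is a linear_char by apply/char_abelianP.
exists 'chi_i; split=> [x y|x|].
- by rewrite -lin_charM ?in_setT.
- by rewrite normC_lin_char ?in_setT.
apply/existsP; apply: contraR i_neq0; rewrite negb_exists => /forallP all1.
rewrite -irr_eq1; apply/eqP/cfunP=> x; rewrite cfun1E in_setT.
by have := all1 x; rewrite negbK => /eqP.
Qed.

Lemma expf_card_pred (x : K) : x != 0 -> x ^+ #|K|.-1 = 1.
Proof.
have K_gt1 : (1 < #|K|)%N by apply: finNzRing_gt1.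
move=> x0; have := expf_card x; rewrite -(prednK (ltnW K_gt1)) exprS.
by rewrite -[X in _ = X]mulr1 => /(mulfI x0).
Qed.

(** The multiplicative group of a finite field is cyclic. *)
Lemma exists_generator : exists g : K, #|K|.-1.-primitive_root g.
Proof.
have K_gt1 : (1 < #|K|)%N by apply: finNzRing_gt1.
have N_gt0 : (0 < #|K|.-1)%N by case: #|K| K_gt1 => [|[]].
have /hasP[g _ gN] : has (#|K|.-1).-primitive_root (enum (predC1 (0 : K))).
  apply: has_prim_root => //; last by rewrite -cardE cardC1.
    by apply/allP=> x; rewrite mem_enum => x0; apply/unity_rootP/expf_card_pred.
  exact: enum_uniq.
by exists g.
Qed.

(** A generator of the group of multiplicative characters. The last clause says
    that its power of order [p] is trivial exactly at the [p]-th powers. *)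
Lemma exists_mult_character :
  exists eta : K -> algC, [/\
    {in predC1 0 &, {morph eta : x y / x * y}},
    forall x : K, x != 0 -> `|eta x| = 1,
    forall x : K, x != 0 -> eta x ^+ #|K|.-1 = 1 &
    forall p (x : K), (0 < p)%N -> (p %| #|K|.-1)%N -> x != 0 ->
      (eta x ^+ (#|K|.-1 %/ p) == 1) = [exists y, y ^+ p == x]].
Proof.
set N := #|K|.-1; have K_gt1 : (1 < #|K|)%N by apply: finNzRing_gt1.
have N_gt0 : (0 < N)%N by rewrite /N; case: #|K| K_gt1 => [|[]].
have xN := expf_card_pred; have [g gN] := exists_generator.
have [z zN] := C_prim_root_exists N_gt0.
have g_neq0 : g != 0.
  apply/eqP => g0; have := prim_expr_order gN.
  by rewrite g0 expr0n gtn_eqF // => /esym/eqP; rewrite oner_eq0.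
(* The discrete logarithm to base [g], composed with exponentiation of [z]. *)
pose eta x := if [pick i : 'I_N | g ^+ i == x] is Some i then z ^+ i else 0.
have etaE i : eta (g ^+ i) = z ^+ i.
  rewrite /eta; case: pickP => [j /eqP gji|/(_ (Ordinal (ltn_pmod i N_gt0)))].
    by apply/eqP; rewrite (eq_prim_root_expr zN) -(eq_prim_root_expr gN) gji.
  by rewrite /= (eq_prim_root_expr gN) modn_mod eqxx.
have logP (x : K) : x != 0 -> exists i, x = g ^+ i.
  by move=> x0; have [i ->] := prim_rootP gN (xN x x0); exists i.
exists eta; split=> [x y /logP[i ->] /logP[j ->]|x|x|p x p0 pN].
- by rewrite -exprD !etaE exprD.
- move=> /logP[i ->]; rewrite etaE.
  apply/eqP; rewrite -(pexpr_eq1 N_gt0) // -normrX -exprM mulnC exprM.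
  by rewrite (prim_expr_order zN) expr1n normr1.
- move=> /logP[i ->]; rewrite etaE -exprM mulnC exprM.
  by rewrite (prim_expr_order zN) expr1n.
have m0 : (0 < N %/ p)%N by rewrite divn_gt0 // dvdn_leq.
move=> /logP[i ->]; rewrite etaE -exprM -(prim_order_dvd zN).
rewrite -{1}(divnK pN) [(N %/ p * _)%N]mulnC dvdn_pmul2r //.
apply/idP/existsP => [/dvdnP[j ->]|[y /eqP yp]].
  by exists (g ^+ j); rewrite exprM.
have /logP[j yj] : y != 0.
  apply: contraNneq (expf_neq0 i g_neq0) => y0.
  by rewrite -yp y0 expr0n gtn_eqF.
move/eqP: yp; rewrite yj -exprM (eq_prim_root_expr gN) => /eqP jpi.
by rewrite /dvdn -(modn_dvdm i pN) -jpi modn_dvdm // modnMl.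
Qed.

End Characters.

(** * Additive Fourier analysis and a bound for Gauss sums *)

Section ExponentialSums.

Variables (K : finFieldType) (psi : K -> algC).
Hypothesis psiD : forall x y, psi (x + y) = psi x * psi y.
Hypothesis norm_psi : forall x, `|psi x| = 1.
Hypothesis psi_nontriv : exists x, psi x != 1.

Let add_char (c x : K) := psi (c * x).

Let K0 : #|K|%:R != 0 :> algC.
Proof. by rewrite pnatr_eq0 -lt0n; apply: ltnW (finNzRing_gt1 K). Qed.

Lemma psi_neq0 x : psi x != 0.
Proof. by rewrite -normr_eq0 norm_psi oner_eq0. Qed.

Lemma psi0 : psi 0 = 1.
Proof. by apply: (mulfI (psi_neq0 0)); rewrite mulr1 -psiD addr0. Qed.

Lemma psiN x : psi (- x) = (psi x)^*.
Proof.
apply: (mulfI (psi_neq0 x)); rewrite -psiD subrr psi0.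
by rewrite -normCK norm_psi expr1n.
Qed.

Lemma sum_psi (z : K) :
  \sum_(y : K) psi (y * z) = if z == 0 then #|K|%:R else 0.
Proof.
case: eqP => [->|/eqP z0].
  rewrite (eq_bigr (fun=> 1)) ?sumr_const // => y _; by rewrite mulr0 psi0.
have [x psix] := psi_nontriv.
set S := \sum_y _; have : psi x * S = S.
  rewrite {2}/S (reindex (fun y => y + x / z)) /=.
    rewrite mulr_sumr; apply: eq_bigr => y _.
    by rewrite mulrDl mulfVK // psiD mulrC.
  by exists (fun y => y - x / z) => y _; rewrite ?addrK ?subrK.
move/eqP; rewrite -subr_eq0 -{2}[S]mul1r -mulrBl mulf_eq0 subr_eq0.
by rewrite (negPf psix) => /eqP.
Qed.

Lemma add_charD (i j x : K) : predT x ->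
  add_char (i + j) x = add_char i x * add_char j x.
Proof. by rewrite /add_char mulrDl psiD. Qed.

Lemma add_char0 (x : K) : predT x -> add_char 0 x = 1.
Proof. by rewrite /add_char mul0r psi0. Qed.

(** All additive characters have the form x |-> psi (c * x), so they are indexed
    by the field itself, the trivial one having index 0. *)
Definition add_fourier_le := fourier_le add_char predT.

Section Subgroups.

(** [V] is an additive subgroup. *)
Definition subgroup_closed (V : {set K}) :=
  0 \in V /\ {in V &, forall x y, x - y \in V}.

(** The indicator function of [V]. *)
Definition ind (V : {set K}) (x : K) : algC := (x \in V)%:R.

(** The characters that are trivial on [V]. *)
Definition annih (V : {set K}) : {set K} :=
  [set c | [forall v in V, psi (c * v) == 1]].

Lemma sum_subgroup_psi V c : subgroup_closed V ->
  \sum_(v in V) psi (c * v) = #|V|%:R * ind (annih V) c.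
Proof.
move=> [V0 VB]; rewrite /ind inE; case: forallP => [all1|].
  rewrite mulr1 (eq_bigr (fun=> 1)) ?sumr_const // => v vV.
  by have := all1 v; rewrite vV => /eqP.
move/forallP; rewrite negb_forall mulr0 => /existsP[w].
rewrite negb_imply => /andP[wV pw].
have VN x : x \in V -> - x \in V by move=> ?; rewrite -sub0r VB.
have VD x y : x \in V -> y \in V -> x + y \in V.
  by move=> ? ?; rewrite -[y]opprK VB // VN.
set S := \sum_(v in V) _; have : psi (c * w) * S = S.
  rewrite {2}/S (reindex (fun y => y + w)) /=.
    rewrite mulr_sumr; apply: eq_big => [y|y _].
      by apply/idP/idP => [yV|ywV]; [apply: VD|rewrite -[y](addrK w) VB].
    by rewrite mulrDr psiD mulrC.
  by exists (fun y => y - w) => y _; rewrite ?addrK ?subrK.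
move/eqP; rewrite -subr_eq0 -{2}[S]mul1r -mulrBl mulf_eq0 subr_eq0.
by rewrite (negPf pw) => /eqP.
Qed.

Lemma ind_fourier V x : subgroup_closed V ->
  ind V x = \sum_c #|V|%:R / #|K|%:R * ind (annih V) c * psi (c * x).
Proof.
move=> cV; have annihN c : ind (annih V) (- c) = ind (annih V) c.
  rewrite /ind !inE; congr (nat_of_bool _)%:R.
  apply: eq_forallb => v; congr (_ ==> _).
  by rewrite mulNr psiN fmorph_eq1.
transitivity (\sum_c \sum_(v in V) #|K|%:R^-1 * psi (c * (x - v))).
  rewrite exchange_big /= (eq_bigr (fun v => (v == x)%:R)); last first.
    move=> v _; rewrite -mulr_sumr sum_psi subr_eq0 eq_sym.
    by case: eqP => _; rewrite ?mulr0 ?mulVf.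
  rewrite /ind; case: (boolP (x \in V)) => xV.
    rewrite (bigD1 x) //= eqxx big1 ?addr0 // => v /andP[_ /negPf ->] //.
  rewrite big1 // => v vV; case: eqP => // vx; by rewrite -vx vV in xV.
apply: eq_bigr => c _; rewrite -annihN.
rewrite [_ / _]mulrC -[_ * _ * ind _ _]mulrA -sum_subgroup_psi //.
rewrite mulr_sumr mulr_suml; apply: eq_bigr => v _.
by rewrite -mulrA -psiD mulrBr mulNr addrC.
Qed.

Lemma fourier_coef_le (b : K -> algC) u :
  (forall x, u x = \sum_c b c * psi (c * x)) ->
  add_fourier_le u (\sum_c `|b c|).
Proof.
move=> ub; exists [seq (b c, c) | c <- index_enum K] => [x _|];
  by rewrite big_map // ub.
Qed.

(** The Fourier coefficients of the indicator of a subgroup are nonnegative, so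
    their absolute sum is the value at 0. *)
Lemma ind_fourier_le V : subgroup_closed V -> add_fourier_le (ind V) 1.
Proof.
move=> cV; have <- : \sum_c `|#|V|%:R / #|K|%:R * ind (annih V) c| = 1.
  transitivity (ind V 0); last by rewrite /ind cV.1.
  rewrite ind_fourier //; apply: eq_bigr => c _.
  rewrite mulr0 psi0 mulr1 ger0_norm //.
  by rewrite !mulr_ge0 ?invr_ge0 ?ler0n.
by apply: fourier_coef_le => x; apply: ind_fourier.
Qed.

(** The coefficients are again nonnegative, since a character that is trivial on
    [V1] is trivial on [V2]; their sum is the value at 0. *)
Lemma ind_centered_fourier_le V1 V2 :
  subgroup_closed V1 -> subgroup_closed V2 -> V2 \subset V1 ->
  add_fourier_le (fun x => ind V2 x - #|V2|%:R / #|V1|%:R * ind V1 x)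
    (1 - #|V2|%:R / #|V1|%:R).
Proof.
move=> cV1 cV2 V21; have V1_gt0 : #|V1|%:R != 0 :> algC.
  by rewrite pnatr_eq0 -lt0n; apply/card_gt0P; exists 0; apply: cV1.1.
pose b c : algC := #|V2|%:R / #|K|%:R * (ind (annih V2) c - ind (annih V1) c).
have ub x : ind V2 x - #|V2|%:R / #|V1|%:R * ind V1 x =
    \sum_c b c * psi (c * x).
  rewrite (ind_fourier x cV1) (ind_fourier x cV2) mulr_sumr -sumrB.
  by apply: eq_bigr => c _; rewrite /b; field; rewrite V1_gt0 K0.
suff <- : \sum_c `|b c| = 1 - #|V2|%:R / #|V1|%:R by apply: fourier_coef_le.
have := ub 0; rewrite /ind cV1.1 cV2.1 mulr1 => ->.
apply: eq_bigr => c _; rewrite mulr0 psi0 mulr1 ger0_norm //.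
rewrite !mulr_ge0 ?invr_ge0 ?ler0n // /ind subr_ge0 ler_nat !inE.
case: forallP => // all1; case: forallP => // -[] v; apply/implyP => vV.
by have := all1 v; rewrite (subsetP V21).
Qed.

Lemma ind_diff_fourier_le V1 V2 :
  subgroup_closed V1 -> subgroup_closed V2 -> V2 \subset V1 ->
  add_fourier_le (fun x => ind V1 x - ind V2 x)
    (2%:R * (1 - #|V2|%:R / #|V1|%:R)).
Proof.
move=> cV1 cV2 V21; have le1 : #|V2|%:R / #|V1|%:R <= 1 :> algC.
  by rewrite -subr_ge0; apply: fourier_le_ge0 (ind_centered_fourier_le _ _ V21).
set rho : algC := _ / _ in le1 *.
have -> : 2%:R * (1 - rho) = `|1 - rho| * 1 + `|-1| * (1 - rho).
  by rewrite normrN1 ger0_norm ?subr_ge0 //; ring.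
have h1 := fourier_leZ add_charD add_char0 (1 - rho) (ind_fourier_le cV1).
have h2 := fourier_leZ add_charD add_char0 (-1)
  (ind_centered_fourier_le cV1 cV2 V21).
apply: fourier_le_ext (fourier_leD h1 h2) => x _; rewrite /rho; ring.
Qed.

End Subgroups.

Lemma card_expf_eq_le r (b : K) :
  (0 < r)%N -> (#|[pred a : K | a ^+ r == b]| <= r)%N.
Proof.
move=> r0; have szp : size ('X^r - b%:P) = r.+1 by rewrite size_XnsubC.
rewrite -ltnS -szp cardE; apply: max_poly_roots (enum_uniq _).
  by rewrite -size_poly_eq0 szp.
apply/allP=> a; rewrite mem_enum inE => /eqP ab.
by rewrite /root !hornerE ab subrr.
Qed.

(** Raising the argument to the [r]-th power covers each point at most [r]
    times. *)
Lemma sum_expf_le r (g : K -> algC) (y : K) :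
  (0 < r)%N -> y != 0 -> (forall z, 0 <= g z) ->
  \sum_(c : K | c != 0) g (c ^+ r * y) <= r%:R * \sum_z g z.
Proof.
move=> r0 y0 g0.
rewrite (partition_big (fun c => c ^+ r * y) predT) //= mulr_sumr.
apply: ler_sum => z _; rewrite (eq_bigr (fun=> g z)); last first.
  by move=> c /andP[_ /eqP ->].
rewrite sumr_const -[leLHS]mulr_natl ler_wpM2r // ler_nat.
apply: leq_trans (card_expf_eq_le (z / y) r0); apply: subset_leq_card.
apply/subsetP => c; rewrite !inE => /andP[_ /eqP <-].
by rewrite mulfK.
Qed.

(** Replacing [a] by [c * a] shows that the modulus of the sum is the same at
    [y] and at [c ^+ r * y]. Averaging over [c] bounds its square by the mean
    square over all [y], which is computed by orthogonality. *)
Lemma gauss_sum_le (chi : K -> algC) r (y : K) :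
  {in predC1 0 &, {morph chi : a b / a * b}} ->
  (forall a : K, a != 0 -> `|chi a| = 1) -> (0 < r)%N -> y != 0 ->
  `|\sum_(a : K | a != 0) chi a * psi (y * a ^+ r)| <= r%:R * sqrtC #|K|%:R.
Proof.
move=> chiM norm_chi r0 y0.
pose S (z : K) := \sum_(a : K | a != 0) chi a * psi (z * a ^+ r).
have K1 : (1 < #|K|)%N by apply: finNzRing_gt1.
pose N := #|K|.-1; have N0 : (0 < N)%N by rewrite /N; case: #|K| K1 => [|[]].
have cardN : #|[pred a : K | a != 0]| = N.
  by rewrite /N -(cardC1 (0 : K)); apply: eq_card.
have S_scale (c : K) : c != 0 -> S y = chi c * S (c ^+ r * y).
  move=> c0; rewrite /S (reindex (fun a => c * a)) /=; last first.
    by exists (fun a => c^-1 * a) => a _; rewrite ?mulKf ?mulVKf.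
  rewrite mulr_sumr; apply: eq_big => [a|a].
    by rewrite mulf_eq0 (negPf c0).
  rewrite mulf_eq0 (negPf c0) /= => a0.
  by rewrite chiM ?inE // exprMn mulrA; congr (_ * psi _); ring.
have sumS : \sum_z `|S z| ^+ 2 <= #|K|%:R * (N%:R * r%:R).
  have S0 : 0 <= \sum_z `|S z| ^+ 2.
    by apply: sumr_ge0 => z _; apply: exprn_ge0.
  rewrite -(ger0_norm S0) {S0}.
  have -> : \sum_z `|S z| ^+ 2 = \sum_(a : K | a != 0) \sum_(a' : K | a' != 0)
      chi a * (chi a')^* * (if a ^+ r - a' ^+ r == 0 then #|K|%:R else 0).
    transitivity (\sum_z \sum_(a : K | a != 0) \sum_(a' : K | a' != 0)
        chi a * (chi a')^* * psi (z * (a ^+ r - a' ^+ r))).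
      apply: eq_bigr => z _; rewrite normCK /S mulr_suml; apply: eq_bigr => a _.
      rewrite rmorph_sum mulr_sumr; apply: eq_bigr => a' _.
      by rewrite rmorphM /= -psiN mulrBr psiD; ring.
    rewrite exchange_big; apply: eq_bigr => a _ /=.
    rewrite exchange_big; apply: eq_bigr => a' _ /=.
    by rewrite -mulr_sumr sum_psi.
  have -> : #|K|%:R * (N%:R * r%:R) =
      \sum_(a : K | a != 0) #|K|%:R * r%:R :> algC.
    by rewrite sumr_const cardN -[RHS]mulr_natl mulrCA.
  apply: le_trans (ler_norm_sum _ _ _) _; apply: ler_sum => a a0.
  apply: le_trans (ler_norm_sum _ _ _) _.
  apply: (@le_trans _ _ (\sum_(a' : K | a' ^+ r == a ^+ r) #|K|%:R)).
    rewrite big_mkcond [leRHS]big_mkcond; apply: ler_sum => a' _.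
    rewrite subr_eq0 [a ^+ r == _]eq_sym; case: (a' ^+ r == a ^+ r); last first.
      by rewrite mulr0 normr0; case: ifP.
    case: ifP => // a'0.
    by rewrite !normrM norm_conjC !norm_chi // !mul1r normr_nat.
  rewrite sumr_const -[leLHS]mulr_natr ler_wpM2l ?ler0n // ler_nat.
  exact: card_expf_eq_le.
have : N%:R * `|S y| ^+ 2 <= N%:R * (r%:R * sqrtC #|K|%:R) ^+ 2.
  have -> : N%:R * `|S y| ^+ 2 = \sum_(c : K | c != 0) `|S (c ^+ r * y)| ^+ 2.
    rewrite (eq_bigr (fun=> `|S y| ^+ 2)); last first.
      by move=> c c0; rewrite (S_scale c c0) normrM norm_chi ?mul1r.
    by rewrite sumr_const cardN mulr_natl.
  apply: le_trans (sum_expf_le (g := fun z => `|S z| ^+ 2) r0 y0 _) _.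
    by move=> z; rewrite exprn_ge0.
  apply: le_trans (ler_wpM2l (ler0n _ r) sumS) _.
  by rewrite exprMn sqrtCK le_eqVlt; apply/orP; left; apply/eqP; ring.
rewrite ler_pM2l ?ltr0n // ler_pXn2r ?nnegrE //.
by rewrite mulr_ge0 ?ler0n ?sqrtC_ge0.
Qed.

End ExponentialSums.

(** * Correlation of a multiplicative and an additive function *)

Section Correlation.

Variables (K : finFieldType) (psi eta : K -> algC).
Hypothesis psiD : forall x y, psi (x + y) = psi x * psi y.
Hypothesis norm_psi : forall x, `|psi x| = 1.
Hypothesis psi_nontriv : exists x, psi x != 1.
Hypothesis etaM : {in predC1 0 &, {morph eta : x y / x * y}}.
Hypothesis norm_eta : forall x, x != 0 -> `|eta x| = 1.
Hypothesis eta_order : forall x, x != 0 -> eta x ^+ #|K|.-1 = 1.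
Hypothesis eta_power : forall p (x : K),
  (0 < p)%N -> (p %| #|K|.-1)%N -> x != 0 ->
  (eta x ^+ (#|K|.-1 %/ p) == 1) = [exists y, y ^+ p == x].

(** All multiplicative characters are powers of [eta]. *)
Definition mult_fourier_le : (K -> algC) -> algC -> Prop :=
  fourier_le (fun (j : nat) x => eta x ^+ j) (predC1 0).

Let mult_charD (i j : nat) x :
  (predC1 (0 : K)) x -> eta x ^+ (i + j)%R = eta x ^+ i * eta x ^+ j.
Proof. by rewrite exprD. Qed.

Let mult_char0 x : (predC1 (0 : K)) x -> eta x ^+ (0 : nat) = 1.
Proof. by []. Qed.

(** The trivial additive character, whose coefficient in [Z] is the mean [b],
    contributes the main term; every pair with a nontrivial additive character
    contributes a Gauss sum. *)
Lemma correlation_le u Z A B b r :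
  mult_fourier_le u A -> add_fourier_le psi Z B ->
  \sum_x Z x = #|K|%:R * b -> (0 < r)%N ->
  `|\sum_(a | a != 0) u a * Z (a ^+ r) - b * \sum_(a | a != 0) u a|
    <= A * (B - `|b|) * (r%:R * sqrtC #|K|%:R).
Proof.
move=> [s us sA] [t Zt tB] sumZ r0.
have K0 : #|K|%:R != 0 :> algC.
  by rewrite pnatr_eq0 -lt0n; apply: ltnW (finNzRing_gt1 K).
have bE : b = \sum_(c <- t | c.2 == 0) c.1.
  apply: (mulfI K0); rewrite -sumZ (eq_bigr _ (fun x _ => Zt x isT)).
  rewrite exchange_big mulr_sumr [RHS]big_mkcond; apply: eq_bigr => c _ /=.
  rewrite -mulr_sumr; under eq_bigr do rewrite mulrC.
  rewrite (sum_psi psiD norm_psi psi_nontriv).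
  by case: ifP; rewrite ?mulr0 // mulrC.
have tb : \sum_(c <- t | c.2 != 0) `|c.1| <= B - `|b|.
  rewrite lerBrDr; apply: le_trans tB.
  rewrite [leRHS](bigID (fun c => c.2 == 0)).
  by rewrite addrC lerD2r bE ler_norm_sum.
have -> : \sum_(a | a != 0) u a * Z (a ^+ r) - b * \sum_(a | a != 0) u a =
    \sum_(d <- s) \sum_(c <- t | c.2 != 0)
      d.1 * c.1 * \sum_(a | a != 0) eta a ^+ d.2 * psi (c.2 * a ^+ r).
  transitivity (\sum_(a | a != 0) \sum_(d <- s) \sum_(c <- t | c.2 != 0)
      d.1 * eta a ^+ d.2 * (c.1 * psi (c.2 * a ^+ r))).
    rewrite mulr_sumr -sumrB; apply: eq_bigr => a a0.
    rewrite [b * _]mulrC -mulrBr us // mulr_suml; apply: eq_bigr => d _.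
    rewrite -mulr_sumr; congr (_ * _).
    rewrite Zt // (bigID (fun c => c.2 == 0)) /= bE addrAC -sumrB.
    rewrite big1 ?add0r // => c /eqP ->.
    by rewrite mul0r (psi0 psiD norm_psi) mulr1 subrr.
  rewrite exchange_big; apply: eq_bigr => d _ /=.
  rewrite exchange_big; apply: eq_bigr => c _ /=.
  by rewrite mulr_sumr; apply: eq_bigr => a _; ring.
set G := r%:R * _; have G0 : 0 <= G by rewrite mulr_ge0 ?ler0n ?sqrtC_ge0.
apply: (@le_trans _ _ (\sum_(d <- s) \sum_(c <- t | c.2 != 0)
    `|d.1| * `|c.1| * G)).
  apply: le_trans (ler_norm_sum _ _ _) _; apply: ler_sum => d _.
  apply: le_trans (ler_norm_sum _ _ _) _; apply: ler_sum => c c0.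
  rewrite !normrM ler_wpM2l ?mulr_ge0 //.
  apply: (gauss_sum_le psiD norm_psi psi_nontriv (chi := fun a => eta a ^+ d.2))
    => // [a a' a0 a'0 | a a0]; first by rewrite etaM // exprMn.
  by rewrite normrX norm_eta // expr1n.
under eq_bigr => d _ do rewrite -mulr_suml -mulr_sumr.
rewrite -mulr_suml -mulr_suml ler_wpM2r // ler_pM ?sumr_ge0 //.
Qed.

(** The indicator function of the [p]-th powers. *)
Definition pow_ind (p : nat) (x : K) : algC := [exists y, y ^+ p == x]%:R.

Lemma pow_ind_fourier p x : (0 < p)%N -> (p %| #|K|.-1)%N -> x != 0 ->
  pow_ind p x = p%:R^-1 * \sum_(j < p) eta x ^+ (#|K|.-1 %/ p * j).
Proof.
move=> p0 pN x0; rewrite /pow_ind -eta_power //.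
under eq_bigr do rewrite exprM.
case: eqP => [->|/eqP w1].
  under eq_bigr do rewrite expr1n.
  by rewrite sumr_const card_ord mulVf // pnatr_eq0 -lt0n.
(* A nontrivial root of unity has a vanishing geometric sum. *)
set w := eta x ^+ _ in w1 *; have : w ^+ p - 1 = 0.
  by rewrite /w -exprM divnK // eta_order // subrr.
rewrite subrX1 => /eqP; rewrite mulf_eq0 subr_eq0 (negPf w1) => /eqP ->.
by rewrite mulr0.
Qed.

Lemma pow_ind_centered_fourier_le p : (0 < p)%N -> (p %| #|K|.-1)%N ->
  mult_fourier_le (fun x => p%:R^-1 - pow_ind p x) (1 - p%:R^-1).
Proof.
case: p => // p _ pN; have p0 : p.+1%:R != 0 :> algC by rewrite pnatr_eq0.
exists [seq (- p.+1%:R^-1, (#|K|.-1 %/ p.+1 * (lift ord0 j : 'I_p.+1))%N)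
         | j <- index_enum 'I_p].
  move=> x x0; rewrite pow_ind_fourier // big_map big_ord_recl muln0 expr0.
  rewrite mulrDr mulr1 opprD addNKr mulr_sumr -sumrN.
  by apply: eq_bigr => j _ /=; rewrite mulNr.
rewrite big_map /= sumr_const card_ord normrN ger0_norm ?invr_ge0 ?ler0n //.
rewrite le_eqVlt; apply/orP; left; apply/eqP.
rewrite -[LHS]mulr_natl; apply: (mulIf p0).
by rewrite mulfVK // mulrBl mul1r mulVf // -natr1 addrK.
Qed.

Lemma pow_free_fourier_le p : (0 < p)%N -> (p %| #|K|.-1)%N ->
  mult_fourier_le (fun x => 1 - pow_ind p x) (2%:R * (1 - p%:R^-1)).
Proof.
move=> p0 pN.
have le1 : (p%:R^-1 : algC) <= 1 by rewrite invf_le1 ?ler1n ?ltr0n.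
have h1 := fourier_leD (fourier_le_const mult_char0 (1 - p%:R^-1))
  (pow_ind_centered_fourier_le p0 pN).
have -> : 2%:R * (1 - p%:R^-1) = `|1 - p%:R^-1| + (1 - p%:R^-1) :> algC.
  by rewrite ger0_norm ?subr_ge0 //; ring.
by apply: fourier_le_ext h1 => x _; rewrite addrA subrK.
Qed.

End Correlation.

(** * Densities of points avoiding the images of coprime maps *)

Section Densities.

Variables (T : finType) (D : pred T) (J : eqType).
Variables (m : J -> T -> T) (kappa : J -> nat).

(** The indicator function of the image of [m j]. *)
Definition img_ind (j : J) (x : T) : algC := [exists y, m j y == x]%:R.

(** The indicator function of the points outside the image of [m j] for every
    [j] in [S]. *)
Definition avoid (S : seq J) (x : T) : algC := \prod_(j <- S) (1 - img_ind j x).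

(** [m j] maps [D] to itself and its complement to itself, and each nonempty
    fibre over [D] has [kappa j] elements. *)
Definition regular_map (j : J) : Prop :=
  [/\ (0 < kappa j)%N, forall y, D (m j y) = D y &
    forall y, D y -> #|[pred y' | m j y' == m j y]| = kappa j].

(** [m j] maps neither into nor out of the image of [m i]. This replaces a
    coprimality assumption on [i] and [j]. *)
Definition preserves (j i : J) : Prop :=
  forall y, D y -> img_ind i (m j y) = img_ind i y.

Lemma sum_img_ind j u : regular_map j ->
  \sum_(x | D x) img_ind j x * u x =
    (kappa j)%:R^-1 * \sum_(y | D y) u (m j y).
Proof.
move=> [k0 mD fib]; rewrite [in RHS](partition_big (m j) D) /=; last first.
  by move=> y; rewrite mD.
rewrite mulr_sumr; apply: eq_bigr => x Dx.
rewrite (eq_bigr (fun=> u x)) => [|y /andP[_ /eqP ->] //].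
rewrite sumr_const /img_ind; case: existsP => [[y /eqP yx]|no].
  have Dy : D y by rewrite -mD yx.
  rewrite mul1r -(fib y Dy) yx.
  have -> : #|[pred y' | D y' & m j y' == x]| = #|[pred y' | m j y' == x]|.
    apply: eq_card => z; rewrite !inE; case: eqP => [zx|]; rewrite ?andbF //.
    by rewrite -mD zx Dx.
  have c0 : (0 < #|[pred y' | m j y' == x]|)%N.
    by apply/card_gt0P; exists y; rewrite inE yx.
  by rewrite -[u x *+ _]mulr_natl mulKf // pnatr_eq0 -lt0n.
rewrite mul0r (@eq_card0 _ [pred y | _]) ?mulr0 // => y; rewrite !inE.
by apply/andP => -[_ yx]; apply: no; exists y.
Qed.

Lemma avoid_preserved S j : (forall i, i \in S -> preserves j i) ->
  forall y, D y -> avoid S (m j y) = avoid S y.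
Proof.
move=> pres y Dy; rewrite /avoid big_seq [RHS]big_seq.
by apply: eq_bigr => i iS; rewrite pres.
Qed.

(** Being in the image of [m j] is independent of avoiding the images indexed
    by [S]. *)
Lemma sum_avoid_centered S j : regular_map j ->
  (forall i, i \in S -> preserves j i) ->
  \sum_(x | D x) avoid S x * ((kappa j)%:R^-1 - img_ind j x) = 0.
Proof.
move=> reg pres.
under eq_bigr do rewrite mulrBr [_ * img_ind _ _]mulrC [_ * _^-1]mulrC.
rewrite sumrB -mulr_sumr sum_img_ind //.
under [in X in _ - X]eq_bigr => y Dy do rewrite (avoid_preserved pres Dy).
by rewrite subrr.
Qed.

Lemma sum_avoid S : uniq S -> (forall j, j \in S -> regular_map j) ->
  (forall i j, i \in S -> j \in S -> i != j -> preserves j i) ->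
  \sum_(x | D x) avoid S x =
    #|[pred x | D x]|%:R * \prod_(j <- S) (1 - (kappa j)%:R^-1).
Proof.
elim: S => [|j S IHS] /= uS reg pres.
  under eq_bigr do rewrite /avoid big_nil.
  by rewrite big_nil mulr1 sumr_const.
have /andP[jS {}uS] := uS.
have presj i : i \in S -> preserves j i.
  move=> iS; apply: pres; rewrite ?inE ?eqxx ?iS ?orbT //.
  by apply: contraNneq jS => <-.
transitivity (\sum_(x | D x)
    (avoid S x * ((kappa j)%:R^-1 - img_ind j x) +
     (1 - (kappa j)%:R^-1) * avoid S x)).
  by apply: eq_bigr => x _; rewrite /avoid big_cons; ring.
rewrite big_split /= sum_avoid_centered ?add0r //; last first.
  by apply: reg; rewrite mem_head.
rewrite -mulr_sumr IHS //; first by rewrite big_cons; ring.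
- by move=> i iS; apply: reg; rewrite inE iS orbT.
by move=> i k iS kS; apply: pres; rewrite inE ?iS ?kS orbT.
Qed.

End Densities.

(** * The action of polynomials by linearized polynomials *)

Section LinearizedAction.

Variables (F : finFieldType) (L : fieldExtType F).
Let K : finFieldType := finvect_type L.
Let q := #|F|.
Let n := \dim {:L}.
Local Notation act := (@poly_act F L).
Implicit Types (h : {poly F}) (a b : L).

Lemma card_field_gt1 : (1 < q)%N.
Proof. exact: finNzRing_gt1. Qed.

Lemma card_finvect : #|K| = (q ^ n)%N.
Proof.
rewrite /n dimvf -[dim L]mul1n -card_mx.
apply: (@bij_eq_card _ _ (VectorInternalTheory.v2r : K -> _)).
by exists VectorInternalTheory.r2v;
  [apply: VectorInternalTheory.v2rK|apply: VectorInternalTheory.r2vK].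
Qed.

(** The cardinality of [F] is a power of the characteristic. *)
Lemma card_pchar_nat : ([pchar L]%R).-nat q.
Proof.
have [p p_pr pF] := finPcharP F.
have pL : p \in [pchar L] by rewrite (pchar_lalg L).
rewrite (eq_pnat _ (pcharf_eq pL)) /q.
by rewrite -[#|F|]/(#|pPrimeCharType pF|) card_pprimeChar pnatX pnat_id.
Qed.

Lemma frobD i (a b : L) : (a + b) ^+ (q ^ i) = a ^+ (q ^ i) + b ^+ (q ^ i).
Proof. by rewrite exprDn_pchar // pnatX card_pchar_nat. Qed.

Lemma frob0 i : (0 : L) ^+ (q ^ i) = 0.
Proof. by rewrite expr0n expn_eq0 -leqn0 leqNgt (ltnW card_field_gt1). Qed.

Lemma frobZ i (c : F) (a : L) : (c *: a) ^+ (q ^ i) = c *: a ^+ (q ^ i).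
Proof.
rewrite exprZn; congr (_ *: _); elim: i => // i IHi.
by rewrite expnSr exprM IHi expf_card.
Qed.

Lemma frob_sum i (I : Type) (r : seq I) (P : pred I) (u : I -> L) :
  (\sum_(j <- r | P j) u j) ^+ (q ^ i) = \sum_(j <- r | P j) u j ^+ (q ^ i).
Proof. exact: (big_morph (fun a : L => a ^+ (q ^ i)) (frobD i) (frob0 i)). Qed.

Lemma poly_act_widen m h a : (size h <= m)%N ->
  act h a = \sum_(i < m) h`_i *: a ^+ (q ^ i).
Proof.
move=> hm; rewrite /poly_act.
rewrite (big_ord_widen m (fun i => h`_i *: a ^+ (q ^ i))) //.
rewrite big_mkcond; apply: eq_bigr => i _; case: ltnP => // /(nth_default 0) ->.
by rewrite scale0r.
Qed.

Lemma poly_actDl h h' a : act (h + h') a = act h a + act h' a.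
Proof.
pose m := maxn (size h) (size h').
rewrite (@poly_act_widen m) ?(leq_trans (size_polyD _ _)) //.
rewrite (@poly_act_widen m h) ?leq_maxl //.
rewrite (@poly_act_widen m h') ?leq_maxr // -big_split.
by apply: eq_bigr => i _; rewrite coefD scalerDl.
Qed.

Lemma poly_actZ c h a : act (c *: h) a = c *: act h a.
Proof.
rewrite (@poly_act_widen (size h) (c *: h)) ?size_scale_leq // scaler_sumr.
by apply: eq_bigr => i _; rewrite coefZ scalerA.
Qed.

Lemma poly_actDr h a b : act h (a + b) = act h a + act h b.
Proof.
by rewrite -big_split; apply: eq_bigr => i _; rewrite frobD scalerDr.
Qed.

Lemma poly_act0 h : act h 0 = 0.
Proof. by apply: (addIr (act h 0)); rewrite -poly_actDr !add0r. Qed.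

Lemma poly_actN h a : act h (- a) = - act h a.
Proof. by apply/eqP; rewrite -addr_eq0 -poly_actDr addNr poly_act0. Qed.

Lemma poly_actXn i a : act 'X^i a = a ^+ (q ^ i).
Proof.
rewrite /poly_act size_polyXn big_ord_recr /= coefXn eqxx scale1r.
rewrite big1 ?add0r //.
by move=> j _; rewrite coefXn ltn_eqF ?scale0r.
Qed.

Lemma poly_act1 a : act 1 a = a.
Proof. by rewrite -(expr0 'X) poly_actXn expr1. Qed.

Lemma poly_actMX h a : act (h * 'X) a = act h (a ^+ q).
Proof.
rewrite (@poly_act_widen (size h).+1); last first.
  by rewrite (leq_trans (size_polyMleq _ _)) // size_polyX addn2.
rewrite big_ord_recl coefMX eqxx scale0r add0r; apply: eq_bigr => i _.
by rewrite coefMX /= expnS exprM.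
Qed.

(** The action commutes with the Frobenius of [F]. *)
Lemma poly_act_frob h a : act h (a ^+ q) = act h a ^+ q.
Proof.
rewrite -[X in _ = _ ^+ X]expn1 frob_sum; apply: eq_bigr => i _.
by rewrite frobZ expn1 -!exprM mulnC.
Qed.

Lemma poly_actM h h' a : act (h * h') a = act h (act h' a).
Proof.
elim/poly_ind: h h' a => [|h c IHh] h' a.
  by rewrite mul0r /poly_act size_poly0 !big_ord0.
rewrite mulrDl -mulrA ['X * h']mulrC !poly_actDl IHh !poly_actMX !poly_act_frob.
rewrite mul_polyC poly_actZ -[c%:P]mulr1 mul_polyC poly_actZ.
by rewrite poly_act1.
Qed.

Lemma poly_act_Xn_sub1 a : act ('X^n - 1) a = 0.
Proof.
rewrite -scaleN1r poly_actDl poly_actZ poly_act1 poly_actXn scaleN1r.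
by rewrite -card_finvect (expf_card (a : K)) subrr.
Qed.

(** Kernel and image of the action of [h]. *)
Definition act_ker (h : {poly F}) : {set K} := [set a : K | act h a == 0].
Definition act_im (h : {poly F}) : {set K} :=
  (fun a : K => act h a : K) @: [set: K].

Lemma act_imP h (x : K) : reflect (exists y : L, act h y = x) (x \in act_im h).
Proof.
by apply: (iffP imsetP) => [[y _ ->]|[y <-]]; exists y.
Qed.

Lemma card_act_fiber h (y : K) :
  #|[pred a : K | act h a == act h y :> L]| = #|act_ker h|.
Proof.
rewrite -(card_imset (act_ker h) (addIr y)); apply: eq_card => a.
rewrite !inE; apply/eqP/imsetP => [ay|[b]].
  exists (a - y); rewrite ?subrK // inE (poly_actDr h (a : L) (- y : L)).
  by rewrite poly_actN ay subrr.
by rewrite inE => /eqP b0 ->; rewrite (poly_actDr h (b : L) (y : L)) b0 add0r.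
Qed.

Lemma card_act_ker_im h : (#|act_ker h| * #|act_im h|)%N = (q ^ n)%N.
Proof.
rewrite -card_finvect -[RHS]sum1_card.
rewrite (partition_big (fun a : K => act h a : K) (mem (act_im h))) /=;
  last by move=> a _; apply/act_imP; exists a.
rewrite mulnC -sum_nat_const; apply: eq_bigr => x /act_imP[y <-].
by rewrite -(card_act_fiber h y) -sum1_card.
Qed.

(** The kernel consists of roots of a linearized polynomial of degree
    [q ^ (size h).-1]. *)
Lemma card_act_ker_le h : h != 0 -> (#|act_ker h| <= q ^ (size h).-1)%N.
Proof.
move=> h0; set d := (size h).-1.
have szh : size h = d.+1 by rewrite /d prednK // lt0n size_poly_eq0.
pose lam : {poly K} := \sum_(i < d.+1) ((h`_i)%:A : L) *: 'X^(q ^ i).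
have q_inj : injective (expn q).
  by move=> i j /eqP; rewrite eqn_exp2l ?card_field_gt1 // => /eqP.
have lam0 : lam != 0.
  apply/eqP => /(congr1 (fun p : {poly K} => p`_(q ^ d))).
  rewrite coef0 coef_sum big_ord_recr big1 /= ?add0r.
    rewrite coefZ coefXn eqxx mulr1 => /eqP.
    by rewrite scaler_eq0 oner_eq0 orbF -lead_coefE lead_coef_eq0 (negPf h0).
  move=> i _; rewrite coefZ coefXn (inj_eq q_inj) gtn_eqF ?mulr0 //.
have szlam : (size lam <= (q ^ d).+1)%N.
  apply: leq_trans (size_sum _ _ _) _; apply/bigmax_leqP => i _.
  apply: leq_trans (size_scale_leq _ _) _.
  rewrite size_polyXn ltnS leq_exp2l ?card_field_gt1 //.
  by rewrite -ltnS.
rewrite -ltnS; apply: leq_trans szlam; rewrite cardE.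
apply: max_poly_roots (enum_uniq _) => //; apply/allP => a.
rewrite mem_enum inE => /eqP ha.
rewrite /root /lam horner_sum -[0 in X in _ == X]ha /poly_act szh.
apply/eqP; apply: eq_bigr => i _; rewrite hornerZ hornerXn.
by rewrite -[RHS](mulr_algl (h`_i) (_ : L)).
Qed.

Section Divisors.

Variables (h h' : {poly F}).
Hypothesis n0 : (0 < n)%N.
Hypothesis hh' : h * h' = 'X^n - 1.

Lemma cofactors_neq0 : h != 0 /\ h' != 0.
Proof.
have : h * h' != 0 by rewrite hh' -size_poly_eq0 size_XnsubC.
by rewrite mulf_eq0 negb_or => /andP.
Qed.

Lemma cofactors_deg : ((size h).-1 + (size h').-1)%N = n.
Proof.
have [h0 h'0] := cofactors_neq0.
have sh : (0 < size h)%N by rewrite lt0n size_poly_eq0.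
have sh' : (0 < size h')%N by rewrite lt0n size_poly_eq0.
have := size_mul h0 h'0; rewrite hh' size_XnsubC //.
by rewrite -{1}(prednK sh) -{1}(prednK sh') addSn addnS => -[] /= <-.
Qed.

Lemma act_im_sub_ker : act_im h \subset act_ker h'.
Proof.
apply/subsetP => x /act_imP[y <-].
by rewrite inE -poly_actM mulrC hh' poly_act_Xn_sub1.
Qed.

(** The upper bounds on the kernels of [h] and [h'] are attained because the
    image of [h] lies in the kernel of [h']. *)
Lemma card_act_ker : #|act_ker h| = (q ^ (size h).-1)%N.
Proof.
have [h0 h'0] := cofactors_neq0; have q0 := ltnW card_field_gt1.
apply/eqP; rewrite eqn_leq card_act_ker_le //=.
rewrite -(leq_pmul2r (m := q ^ (size h').-1)) ?expn_gt0 ?q0 //.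
rewrite -expnD cofactors_deg -(card_act_ker_im h) leq_mul2l.
apply/orP; right.
exact: leq_trans (subset_leq_card act_im_sub_ker) (card_act_ker_le h'0).
Qed.

Lemma card_act_im : #|act_im h| = (q ^ (size h').-1)%N.
Proof.
have q0 := ltnW card_field_gt1.
have := card_act_ker_im h; rewrite card_act_ker -cofactors_deg expnD => /eqP.
by rewrite eqn_pmul2l ?expn_gt0 ?q0 // => /eqP.
Qed.

Lemma act_im_ker : act_im h = act_ker h'.
Proof.
have [_ h'0] := cofactors_neq0.
by apply/eqP; rewrite eqEcard act_im_sub_ker card_act_im card_act_ker_le.
Qed.

End Divisors.

(** The action of [h] as a self-map of the finite type underlying [L]. *)
Definition act_map (h : {poly F}) (a : K) : K := act h a.

Lemma img_ind_act_map h x : img_ind act_map h x = ind (act_im h) x.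
Proof.
rewrite /img_ind /ind; congr (nat_of_bool _)%:R.
by apply/existsP/act_imP => -[y /eqP yx]; exists y => //; apply/eqP.
Qed.

Lemma act_im_closed h : subgroup_closed (act_im h).
Proof.
split=> [|x y /act_imP[a <-] /act_imP[b <-]]; apply/act_imP.
  by exists 0; rewrite poly_act0.
by exists (a - b); rewrite poly_actDr poly_actN.
Qed.

Lemma act_im_mul_sub h h' : act_im (h * h') \subset act_im h.
Proof.
apply/subsetP => x /act_imP[a <-]; apply/act_imP.
by exists (act h' a); rewrite poly_actM.
Qed.

Lemma regular_act_map h : (0 < n)%N -> h %| 'X^n - 1 ->
  regular_map predT act_map (fun h => (q ^ (size h).-1)%N) h.
Proof.
move=> n0 /dvdpP[h' hh']; split=> // [|y _].
  by rewrite expn_gt0 ltnW ?card_field_gt1.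
by rewrite -(@card_act_ker h h' n0) 1?mulrC // -(card_act_fiber h y).
Qed.

Lemma preserves_act_map h h' : coprimep h h' ->
  preserves predT act_map h h'.
Proof.
case/Bezout_eq1_coprimepP => -[u w] /= uw y _; rewrite !img_ind_act_map /ind.
congr (nat_of_bool _)%:R; apply/act_imP/act_imP => -[z].
  move=> hz; exists (act u z + act w y).
  rewrite -[RHS]poly_act1 -uw poly_actDr poly_actDl -!poly_actM.
  rewrite [h' * u]mulrC [h' * w]mulrC poly_actM hz.
  by rewrite /act_map -poly_actM.
by move=> <-; exists (act h z); rewrite -poly_actM mulrC poly_actM.
Qed.

End LinearizedAction.

(** * Monic irreducible divisors *)

Section IrreducibleDivisors.

Variable F : finFieldType.
Implicit Types (P t : {poly F}).

Definition monic_irr (P : {poly F}) : bool := (P \is monic) && irreducibleb P.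

Lemma monic_irrP P : reflect (P \is monic /\ irreducible_poly P) (monic_irr P).
Proof.
by apply: (iffP andP) => -[mP iP]; split=> //; apply/irreducibleP.
Qed.

(** The monic irreducible divisors of a nonzero [t], each listed once. *)
Definition irr_divs (t : {poly F}) : seq {poly F} :=
  [seq P <- map val (enum {: {poly_(size t) F}})
     | monic_irr P && (P %| t)].

Lemma irr_divs_uniq t : uniq (irr_divs t).
Proof.
apply: filter_uniq; rewrite map_inj_uniq ?enum_uniq //.
exact: val_inj.
Qed.

Lemma mem_irr_divs t P : t != 0 ->
  (P \in irr_divs t) = monic_irr P && (P %| t).
Proof.
move=> t0; rewrite mem_filter; apply: andb_idr => /andP[_ Pt].
have szP : (size P <= size t)%N by apply: dvdp_leq.
apply/mapP; by exists (NPoly (n := size t) szP); rewrite ?mem_enum.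
Qed.

Lemma monic_irr_coprime P Q : monic_irr P -> monic_irr Q -> P != Q ->
  coprimep P Q.
Proof.
move=> /monic_irrP[mP iP] /monic_irrP[mQ iQ]; apply: contraNT.
rewrite irreducible_poly_coprime // negbK => PQ.
have sP : size P != 1%N by rewrite gtn_eqF //; case: iP.
by rewrite -(eqp_monic mP mQ); apply: (apply_irredp iQ).
Qed.

Lemma exists_monic_irr_dvd t : (1 < size t)%N ->
  exists2 P, monic_irr P & P %| t.
Proof.
have [m] := ubnP (size t); elim: m t => // m IHm t tm t1.
have t0 : t != 0 by rewrite -size_poly_gt0 ltnW.
have [irr_t|] := pselect (irreducible_poly t).
  have l0 : (lead_coef t)^-1 != 0 by rewrite invr_eq0 lead_coef_eq0.
  exists ((lead_coef t)^-1 *: t); last by rewrite dvdpZl.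
  apply/monic_irrP; split.
    by rewrite monicE lead_coefZ mulVf // lead_coef_eq0.
  split; first by rewrite size_scale.
  move=> d d1 dt; rewrite dvdpZr // in dt.
  apply: eqp_trans (irr_t.2 d d1 dt) _; rewrite eqp_sym; exact: eqp_scale.
move=> nirr.
have [d [d1 dt ndt]] : exists d : {poly F},
    [/\ size d != 1%N, d %| t & ~~ (d %= t)].
  apply: contra_notP nirr => no; split=> // d d1 dt.
  by apply/negPn/negP => ndt; apply: no; exists d.
have d0 : d != 0 by apply: contraTneq dt => ->; rewrite dvd0p.
have szd : (1 < size d)%N.
  by move: d1 d0; rewrite -size_poly_eq0; case: (size d) => [|[]].
have dlt : (size d < size t)%N.
  rewrite ltn_neqAle dvdp_leq // andbT; apply: contra ndt => /eqP sdt.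
  by rewrite -dvdp_size_eqp // sdt.
have [P iP Pd] := IHm d (leq_trans dlt tm) szd.
by exists P => //; apply: dvdp_trans dt.
Qed.

Lemma coprimep_prod_seq (S : seq {poly F}) t :
  (forall P, P \in S -> coprimep t P) -> coprimep t (\prod_(P <- S) P).
Proof.
elim: S => [|P S IHS] cS; first by rewrite big_nil coprimep1.
rewrite big_cons coprimepMr cS ?mem_head //= IHS // => Q QS.
by apply: cS; rewrite inE QS orbT.
Qed.

End IrreducibleDivisors.

Lemma avoidE (T : finType) (J : eqType) (m : J -> T -> T) (S : seq J) x :
  avoid m S x = (~~ has (fun j => [exists y, m j y == x]) S)%:R.
Proof.
rewrite /avoid; elim: S => [|j S IHS] /=; first by rewrite big_nil.
rewrite big_cons IHS /img_ind negb_or.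
by case: [exists y, _]; rewrite ?subrr ?mul0r // subr0 mul1r.
Qed.

(** * Free elements as points avoiding images *)

Section FreeElements.

Variables (F : finFieldType) (L : fieldExtType F).
Let K : finFieldType := finvect_type L.

Lemma Omega_avoid (g : {poly F}) (b : L) : g != 0 ->
  (Omega_ind g b)%:R = avoid (@act_map F L) (irr_divs g) b.
Proof.
move=> g0; rewrite avoidE /Omega_ind; case: asboolP => [free|nfree].
  case: hasP => // -[P]; rewrite mem_irr_divs //.
  case/andP=> /monic_irrP[mP iP] Pg.
  case/existsP => y /eqP yb; case: (free P mP Pg); last by exists y.
  by move=> P1; case: iP; rewrite P1 size_poly1.
case: hasP => // no; case: nfree => h mh hg h1 [c bc]; apply: no.
have h_gt1 : (1 < size h)%N.
  have : (0 < size h)%N by rewrite size_poly_gt0 monic_neq0.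
  rewrite leq_eqVlt => /orP[/eqP/esym/eqP /size_poly1P[a _ ha]|//].
  case: h1; move: mh; rewrite ha monicE lead_coefC => /eqP ->.
  by [].
have [P iP /dvdpP[h' hE]] := exists_monic_irr_dvd h_gt1.
exists P; first by rewrite mem_irr_divs // iP (dvdp_trans _ hg) // hE dvdp_mull.
apply/existsP; exists (poly_act h' c).
by rewrite /act_map -poly_actM mulrC -hE bc.
Qed.

Lemma w_avoid (m : nat) (a : L) : (0 < m)%N ->
  (w_ind m a)%:R = avoid (fun p (x : K) => x ^+ p) (primes m) a.
Proof.
move=> m0; rewrite avoidE /w_ind; case: asboolP => [free|nfree].
  case: hasP => // -[p]; rewrite mem_primes => /and3P[p_pr _ pm].
  case/existsP => y /eqP ya; case: (free p pm) => //; last by exists y.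
  by move=> p1; rewrite p1 in p_pr.
case: hasP => // no; case: nfree => d dm d1 [c ac]; apply: no.
have d_gt1 : (1 < d)%N.
  by case: d dm d1 {ac} => [|[]] //; rewrite dvd0n => /eqP md; rewrite md in m0.
exists (pdiv d).
  by rewrite mem_primes pdiv_prime // m0 (dvdn_trans (pdiv_dvd d)).
apply/existsP; exists ((c : K) ^+ (d %/ pdiv d)).
by rewrite -exprM divnK ?pdiv_dvd // ac.
Qed.

End FreeElements.

(** * Pushforward along the action of a divisor *)

Section Pushforward.

Variables (F : finFieldType) (L : fieldExtType F).
Let K : finFieldType := finvect_type L.
Let q := #|F|.
Let n := \dim {:L}.
Hypothesis n0 : (0 < n)%N.
Let M : {poly F} := 'X^n - 1.
Let kap (P : {poly F}) : nat := (q ^ (size P).-1)%N.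

Variables (f f' : {poly F}).
Hypothesis ff' : f * f' = M.

Local Notation act := (@poly_act F L).
Local Notation amap := (@act_map F L).

Let f'f : f' * f = M. Proof. by rewrite mulrC. Qed.

(** The direct image of [Y] along the action of [f]: the sum of [Y] over each
    fibre. *)
Definition push (Y : K -> algC) (x : K) : algC :=
  \sum_(b : K | amap f b == x) Y b.

Lemma pushE_out Y x : x \notin act_im L f -> push Y x = 0.
Proof.
move=> xf; apply: big1 => b /eqP bx; case/negP: xf.
by apply/act_imP; exists b.
Qed.

(** A factor invariant under the kernel of [f] passes through the direct image;
    the other one is averaged over the cosets of the kernel. *)
Lemma push_mul_invariant (Y1 Y2 : K -> algC) (c : algC) (b : K) :
  (forall b k : K, k \in act_ker L f -> Y1 (b + k) = Y1 b) ->
  \sum_(k in act_ker L f) Y2 (b + k) = c ->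
  push (fun x => Y1 x * Y2 x) (amap f b) = c * Y1 b.
Proof.
move=> inv1 <-; rewrite /push (reindex (fun k => b + k)) /=; last first.
  by exists (fun k => k - b) => k _ /=;
    [rewrite [X in X - _]addrC addrK|rewrite addrC subrK].
rewrite mulr_suml; apply: eq_big => k.
  rewrite inE /act_map (poly_actDr f (b : L) (k : L)).
  by rewrite -subr_eq0 [X in X - _]addrC addrK.
move=> fk; rewrite inv1; first exact: mulrC; rewrite inE.
move: fk; rewrite /act_map (poly_actDr f (b : L) (k : L)).
by rewrite -subr_eq0 [X in X - _]addrC addrK.
Qed.

(** The kernel of [f] is the image of [f']. As [f'] is coprime to the product
    [Q] of [B], this image and the image of [Q] span everything, and avoidance
    of the images of [B] is invariant under the image of [Q] and under the
    action of [f']. Hence its sum over every coset of the kernel is the same. *)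
Lemma sum_ker_avoid (B : seq {poly F}) (b : K) :
  (forall P, P \in B -> coprimep f' P) ->
  \sum_(k in act_ker L f) avoid amap B (b + k) =
    (kap f)%:R / #|K|%:R * \sum_x avoid amap B x.
Proof.
move=> cB; pose Q := \prod_(P <- B) P.
have /Bezout_eq1_coprimepP[[u w] /= uw] : coprimep f' Q.
  exact: coprimep_prod_seq.
have f'_dvd : f' %| M by rewrite -ff' dvdp_mull.
have avoid_Q (x z : K) : avoid amap B (x + amap Q z) = avoid amap B x.
  rewrite /avoid big_seq [RHS]big_seq; apply: eq_bigr => P PB.
  rewrite !img_ind_act_map /ind; congr (1 - (nat_of_bool _)%:R).
  have [Q' QE] : exists Q', Q = P * Q'.
    by rewrite /Q (big_rem P PB); eexists.
  rewrite QE /act_map poly_actM.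
  apply/act_imP/act_imP => -[y yx].
    by exists (y - act Q' z); rewrite poly_actDr poly_actN yx addrK.
  by exists (y + act Q' z); rewrite poly_actDr yx.
transitivity (\sum_(x : K) img_ind amap f' x * avoid amap B (b + x)).
  rewrite big_mkcond; apply: eq_bigr => x _.
  rewrite img_ind_act_map /ind (act_im_ker n0 f'f).
  by case: ifP => _; rewrite ?mul1r ?mul0r.
rewrite (sum_img_ind (D := predT) _ (regular_act_map n0 f'_dvd)).
congr (_ * _).
  have q_neq0 : (q%:R : algC) != 0.
    by rewrite pnatr_eq0 -lt0n ltnW // card_field_gt1.
  rewrite card_finvect -(cofactors_deg n0 ff') /kap expnD natrM invfM.
  by rewrite mulrA divff ?mul1r // natrX expf_neq0.
have bE : b = amap f' (act u b) + amap Q (act w b).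
  rewrite /act_map -!poly_actM -[LHS]poly_act1 -uw poly_actDl.
  by rewrite [f' * u]mulrC [Q * w]mulrC.
(* The component of [b] in the image of [Q] is irrelevant, and [f'] can be
   cancelled. *)
transitivity (\sum_(y : K) avoid amap B ((act u b : K) + y)).
  apply: eq_bigr => y _.
  rewrite -[RHS](avoid_preserved (D := predT) (m := amap) (j := f')) //;
    last first.
    by move=> i iB; apply: preserves_act_map; apply: cB.
  rewrite {1}bE addrAC avoid_Q; congr (avoid _ _ _).
  by rewrite /act_map (poly_actDr f' (act u b) (y : L)).
rewrite [RHS](reindex (fun y => (act u b : K) + y)) //=.
by exists (fun y => y - (act u b : K)) => y _ /=;
  [rewrite [X in X - _]addrC addrK|rewrite addrC subrK].
Qed.

(** For [P] dividing [f'], the image of [P] contains the kernel of [f] and is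
    carried by [f] to the image of [f * P]; for the other [P], averaging over
    the kernel leaves only a density. *)
Lemma push_avoid (S : seq {poly F}) x : uniq S ->
  (forall P, P \in S -> monic_irr P && (P %| M)) ->
  push (avoid amap S) x =
    (kap f)%:R * \prod_(P <- S | ~~ (P %| f')) (1 - (kap P)%:R^-1) *
      (ind (act_im L f) x *
       \prod_(P <- S | P %| f')
          (ind (act_im L f) x - ind (act_im L (f * P)) x)).
Proof.
move=> uS irrS; have [xf|xf] := boolP (x \in act_im L f); last first.
  by rewrite pushE_out // /ind (negPf xf) mul0r mulr0.
have /act_imP[b fbx] := xf.
pose A := [seq P <- S | P %| f']; pose B := [seq P <- S | ~~ (P %| f')].
have splitS y : avoid amap S y = avoid amap A y * avoid amap B y.
  by rewrite /avoid (bigID (fun P => P %| f')) /= !big_filter.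
have -> : push (avoid amap S) x =
    push (fun y => avoid amap A y * avoid amap B y) x.
  by apply: eq_bigr => y _.
have im_f P y : P %| f' -> (act f y \in act_im L (f * P)) = (y \in act_im L P).
  move=> /dvdpP[f'' f'E]; apply/act_imP/act_imP => -[z].
    rewrite poly_actM => fz.
    have : (y - act P z : K) \in act_ker L f.
      by rewrite inE poly_actDr poly_actN fz subrr.
    rewrite -(act_im_ker n0 f'f) => /act_imP[t].
    rewrite f'E mulrC poly_actM => Pt; exists (act f'' t + z).
    by rewrite poly_actDr Pt subrK.
  by move=> <-; exists z; rewrite poly_actM.
rewrite -fbx (@push_mul_invariant _ _ _ b _ (sum_ker_avoid _ _)); first last.
- move=> P; rewrite mem_filter => /andP[PF PS].
  rewrite coprimep_sym irreducible_poly_coprime //.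
  by case/andP: (irrS P PS) => /monic_irrP[].
- move=> y k fk; rewrite /avoid big_seq [RHS]big_seq; apply: eq_bigr => P.
  rewrite mem_filter => /andP[PF _].
  rewrite !img_ind_act_map /ind -(im_f P (y + k)) // -(im_f P y) //.
  rewrite (poly_actDr f (y : L) (k : L)).
  by move: fk; rewrite inE => /eqP ->; rewrite addr0.
rewrite (sum_avoid (D := predT) (kappa := kap)); first last.
- move=> P Q; rewrite !mem_filter => /andP[_ PS] /andP[_ QS] PQ.
  apply: preserves_act_map.
  case/andP: (irrS P PS) => iP _; case/andP: (irrS Q QS) => iQ _.
  by apply: monic_irr_coprime; rewrite // eq_sym.
- move=> P; rewrite mem_filter => /andP[_ PS].
  by apply: regular_act_map; case/andP: (irrS P PS).
- exact: filter_uniq.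
have K0 : #|K|%:R != 0 :> algC.
  by rewrite pnatr_eq0 -lt0n; apply: ltnW (finNzRing_gt1 K).
rewrite (_ : #|[pred _ | predT _]| = #|K|); last by apply: eq_card.
rewrite mulrA mulfVK // !big_filter; congr (_ * _).
rewrite /ind fbx xf mul1r /avoid big_filter.
apply: eq_bigr => P PF; rewrite img_ind_act_map /ind.
by rewrite -im_f // fbx.
Qed.

Variable psi : K -> algC.
Hypothesis psiD : forall x y, psi (x + y) = psi x * psi y.
Hypothesis norm_psi : forall x, `|psi x| = 1.
Hypothesis psi_nontriv : exists x, psi x != 1.

Let char_D (i j x : K) (_ : predT x) :
  psi ((i + j) * x) = psi (i * x) * psi (j * x).
Proof. by rewrite mulrDl psiD. Qed.

Let char_0 (x : K) (_ : predT x) : psi (0 * x) = 1.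
Proof. by rewrite mul0r (psi0 psiD norm_psi). Qed.

(** The image of [f * P] has index [kap P] in the image of [f]. *)
Lemma kap_ratio P : P %| f' ->
  (#|act_im L (f * P)|%:R / #|act_im L f|%:R : algC) = (kap P)%:R^-1.
Proof.
move=> /dvdpP[f'' f'E].
have fP : (f * P) * f'' = M by rewrite -mulrA [P * _]mulrC -f'E.
have Pf : P * (f * f'') = M by rewrite -fP; ring.
have q_neq0 : (q%:R : algC) != 0.
  by rewrite pnatr_eq0 -lt0n ltnW // card_field_gt1.
rewrite (card_act_im n0 fP) (card_act_im n0 ff') f'E.
have := cofactors_neq0 n0 fP; rewrite mulf_eq0 negb_or => -[/andP[_ P0] f''0].
have -> : (size (f'' * P)).-1 = ((size f'').-1 + (size P).-1)%N.
  rewrite size_mul //; move: P0 f''0; rewrite -!size_poly_gt0 => P0 f''0.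
  by rewrite -{1}(prednK P0) -{1}(prednK f''0) addSn addnS.
by rewrite expnD natrM /kap !natrX invfM mulrA divff ?mul1r // expf_neq0.
Qed.

Lemma push_avoid_le (S : seq {poly F}) : uniq S ->
  (forall P, P \in S -> monic_irr P && (P %| M)) ->
  add_fourier_le psi (push (avoid amap S))
    ((kap f)%:R * 2%:R ^+ count (fun P => P %| f') S *
     \prod_(P <- S) (1 - (kap P)%:R^-1)).
Proof.
move=> uS irrS; pose A := [seq P <- S | P %| f'].
have cl h : subgroup_closed (act_im L h) by apply: act_im_closed.
have prodA : add_fourier_le psi
    (fun x => \prod_(P <- A) (ind (act_im L f) x - ind (act_im L (f * P)) x))
    (\prod_(P <- A) (2%:R * (1 - (kap P)%:R^-1))).
  apply: (fourier_le_prod char_D char_0) => P.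
  rewrite mem_filter => /andP[PF _].
  rewrite -kap_ratio //.
  exact: (ind_diff_fourier_le psiD norm_psi psi_nontriv (cl _) (cl _)
    (act_im_mul_sub L f P)).
have indf := ind_fourier_le psiD norm_psi psi_nontriv (cl f).
have := fourier_leM char_D indf prodA.
set c := (kap f)%:R * \prod_(P <- S | ~~ (P %| f')) (1 - (kap P)%:R^-1) : algC.
move/(fourier_leZ char_D char_0 c) => H.
have c0 : 0 <= c.
  rewrite mulr_ge0 ?ler0n // prodr_ge0 // => P _; rewrite subr_ge0.
  by rewrite invf_le1 ?ler1n ?ltr0n expn_gt0 ltnW // card_field_gt1.
rewrite [X in add_fourier_le _ _ X](_ : _ =
   `|c| * (1 * \prod_(P <- A) (2%:R * (1 - (kap P)%:R^-1)))); last first.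
  rewrite ger0_norm // mul1r big_filter big_split /= big_const_seq iter_mulr_1.
  rewrite [in LHS](bigID (fun P => P %| f')) /= /c; ring.
apply: fourier_le_ext H => x _; rewrite push_avoid // /c !big_filter.
by [].
Qed.

(** If [P] does not divide [f'], the left-hand function vanishes identically:
    averaging over the kernel of [f] makes membership in the image of [P]
    independent of everything else. *)
Lemma push_avoid_centered_le (S : seq {poly F}) P : uniq (P :: S) ->
  (forall Q, Q \in P :: S -> monic_irr Q && (Q %| M)) ->
  add_fourier_le psi
    (push (fun x => avoid amap S x * ((kap P)%:R^-1 - img_ind amap P x)))
    ((P %| f')%R%:R * (1 - (kap P)%:R^-1) *
     ((kap f)%:R * 2%:R ^+ count (fun P => P %| f') S *
      \prod_(P <- S) (1 - (kap P)%:R^-1))).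
Proof.
move=> uPS irrS; have /andP[PS uS] := uPS.
have irrS' Q : Q \in S -> monic_irr Q && (Q %| M).
  by move=> QS; apply: irrS; rewrite inE QS orbT.
have E x : push (fun x => avoid amap S x * ((kap P)%:R^-1 - img_ind amap P x)) x
   = push (avoid amap (P :: S)) x - (1 - (kap P)%:R^-1) * push (avoid amap S) x.
  rewrite /push mulr_sumr -sumrB; apply: eq_bigr => y _.
  by rewrite /avoid big_cons; ring.
case: (boolP (P %| f')) => Pf'.
  have cl h : subgroup_closed (act_im L h) by apply: act_im_closed.
  have := fourier_leM char_D
    (ind_centered_fourier_le psiD norm_psi psi_nontriv (cl f) (cl (f * P)) _)
    (push_avoid_le uS irrS').
  rewrite act_im_mul_sub => /(_ isT) H.
  have := fourier_leZ char_D char_0 (-1) H.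
  rewrite normrN1 !mul1r kap_ratio //; apply: fourier_le_ext => x _.
  rewrite E !push_avoid // !big_cons Pf' /=.
  rewrite /ind; case: (x \in act_im L f); last first.
    by rewrite !(mul0r, mulr0, subr0).
  by rewrite (_ : true%:R = 1 :> algC) //; ring.
rewrite !mul0r -(normr0 algC).
apply: fourier_le_ext (fourier_le_const char_0 0) => x _.
rewrite E !push_avoid // !big_cons (negPf Pf') /=; ring.
Qed.

End Pushforward.

(** * Power maps on the multiplicative group *)

Section PowerMaps.

Variable K : finFieldType.

(** The [p]-th power as a self-map of the field. *)
Definition pow_map (p : nat) (x : K) : K := x ^+ p.

Lemma regular_pow_map p : (0 < p)%N -> (p %| #|K|.-1)%N ->
  regular_map (predC1 0) pow_map id p.
Proof.
move=> p0 pN; split=> // [y|y y0].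
  by rewrite /= /pow_map expf_eq0 p0.
apply/eqP; rewrite eqn_leq card_expf_eq_le //=.
have N0 : (0 < #|K|.-1)%N by case: #|K| (finNzRing_gt1 K) => [|[]].
have [g gN] := exists_generator K.
have wp := dvdn_prim_root gN pN.
set w := g ^+ _ in wp.
have inj : injective (fun i : 'I_p => y * w ^+ i).
  move=> i j /(mulfI y0) /eqP; rewrite (eq_prim_root_expr wp).
  by rewrite !modn_small // => /eqP /val_inj.
rewrite -[X in (X <= _)%N]card_ord -(card_codom inj); apply: subset_leq_card.
apply/subsetP => _ /codomP[i ->]; rewrite inE /pow_map exprMn.
rewrite -exprM mulnC exprM.
by rewrite (prim_expr_order wp) expr1n mulr1.
Qed.

Lemma preserves_pow_map p p' : (0 < p)%N -> (0 < p')%N -> coprime p p' ->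
  preserves (predC1 0) pow_map p p'.
Proof.
move=> p0 p'0 pp' y y0; rewrite /img_ind; congr (nat_of_bool _)%:R.
apply/existsP/existsP => -[z /eqP zy]; last first.
  by exists (z ^+ p); rewrite -zy /pow_map -!exprM mulnC.
case: (egcdnP p' p0) => u v uv _; exists (z ^+ u / y ^+ v).
move: pp' uv; rewrite /coprime => /eqP -> uv.
rewrite /pow_map in zy *; rewrite expr_div_n -!exprM [(u * p')%N]mulnC exprM zy.
rewrite -exprM [(p * u)%N]mulnC uv exprD expr1.
by rewrite mulrC mulKf ?expf_neq0.
Qed.

End PowerMaps.

(** * Counting squarefree divisors from below *)

Section SubProducts.

Variables (T : eqType) (mul : T -> T -> T) (one : T) (dv : rel T) (pr : pred T).
Hypothesis dv1 : forall p, pr p -> ~~ dv p one.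
Hypothesis dvM : forall p x y, pr p -> dv p (mul x y) -> dv p x || dv p y.
Hypothesis dv_mul : forall p x, dv p (mul p x).
Hypothesis dv_pr : forall p p', pr p -> pr p' -> dv p p' -> p = p'.
Hypothesis mul_inj : forall p, pr p -> injective (mul p).

(** The products of the [2 ^ size s] subsequences of [s]. *)
Fixpoint subproducts (s : seq T) : seq T :=
  if s is p :: s' then subproducts s' ++ map (mul p) (subproducts s')
  else [:: one].

Lemma size_subproducts s : size (subproducts s) = (2 ^ size s)%N.
Proof.
by elim: s => //= p s IHs; rewrite size_cat size_map IHs addnn -mul2n expnS.
Qed.

Lemma subproducts_ndvd s p x : all pr s -> pr p -> p \notin s ->
  x \in subproducts s -> ~~ dv p x.
Proof.
move=> + pr_p; elim: s x => [|p' s IHs] x /=.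
  by move=> _ _; rewrite inE => /eqP ->; apply: dv1.
case/andP => pr_p' pr_s; rewrite inE negb_or => /andP[pp' ps].
rewrite mem_cat => /orP[|/mapP[y ys ->]]; first exact: IHs.
apply: contra (IHs y pr_s ps ys) => /(dvM pr_p) /orP[/(dv_pr pr_p pr_p')|//].
by move=> pE; rewrite pE eqxx in pp'.
Qed.

Lemma subproducts_uniq s : all pr s -> uniq s -> uniq (subproducts s).
Proof.
elim: s => //= p s IHs /andP[pr_p pr_s] /andP[ps us].
rewrite cat_uniq IHs // map_inj_uniq ?IHs ?andbT //; last exact: mul_inj.
apply/hasPn => _ /mapP[y ys ->]; apply/negP => /(subproducts_ndvd pr_s pr_p ps).
by rewrite dv_mul.
Qed.

Lemma subproducts_ind (G : T -> Prop) s :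
  G one -> (forall p x, pr p -> ~~ dv p x -> G x -> G (mul p x)) ->
  all pr s -> uniq s -> forall x, x \in subproducts s -> G x.
Proof.
move=> G1 GM; elim: s => [|p s IHs] /=.
  by move=> _ _ x; rewrite inE => /eqP ->.
case/andP=> pr_p pr_s /andP[ps us] x; rewrite mem_cat.
case/orP=> [|/mapP[y ys ->]]; first exact: IHs.
by apply: GM (IHs pr_s us y ys) => //; apply: subproducts_ndvd ps ys.
Qed.

End SubProducts.

Lemma W_nat_ge l : (0 < l)%N -> (2 ^ size (primes l) <= W_nat l)%N.
Proof.
move=> l0; rewrite -(size_subproducts muln 1%N) /W_nat -size_filter.
have pr_s : all (fun p => prime p && (p %| l)%N) (primes l).
  by apply/allP => p; rewrite mem_primes => /and3P[-> _ ->].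
apply: uniq_leq_size.
  apply: (subproducts_uniq (dv := dvdn) _ _ _ _ _ pr_s (primes_uniq l)).
  - by move=> p /andP[/prime_gt1 p1 _]; rewrite dvdn1 gtn_eqF.
  - by move=> p x y /andP[p_pr _]; rewrite Euclid_dvdM.
  - by move=> p x; apply: dvdn_mulr.
  - by move=> p p' /andP[p_pr _] /andP[p'_pr _]; rewrite dvdn_prime2 // => /eqP.
  - by move=> p /andP[/prime_gt0 p0 _] x y /eqP; rewrite eqn_pmul2l // => /eqP.
move=> x xs; rewrite mem_filter -dvdn_divisors //.
suff [sqf_x ->] : squarefree_nat x /\ (x %| l)%N.
  by rewrite andbT; apply/asboolP.
move: x xs.
apply: (subproducts_ind (dv := dvdn) _ _ _ _ _ pr_s (primes_uniq l)).
- by move=> p /andP[/prime_gt1 p1 _]; rewrite dvdn1 gtn_eqF.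
- by move=> p x y /andP[p_pr _]; rewrite Euclid_dvdM.
- by move=> p p' /andP[p_pr _] /andP[p'_pr _]; rewrite dvdn_prime2 // => /eqP.
- by split; rewrite ?dvd1n // => e; rewrite dvdn1 (eqn_exp2r e 1) // => /eqP.
move=> p x /andP[p_pr pl] px [sqf_x xl]; split.
  move=> e e2; case: (boolP (p %| e)%N) => pe.
    have : (p * p %| p * x)%N.
      by apply: dvdn_trans e2; rewrite expnS expn1 dvdn_mul.
    by rewrite dvdn_pmul2l ?prime_gt0 // (negPf px).
  apply: sqf_x; rewrite Gauss_dvdr // in e2.
  by rewrite coprimeXl // coprime_sym prime_coprime.
by rewrite Gauss_dvd ?pl // prime_coprime.
Qed.

Lemma W_poly_ge (F : finFieldType) (t : {poly F}) : t != 0 ->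
  (2 ^ size (irr_divs t) <= W_poly t)%N.
Proof.
move=> t0; rewrite -(size_subproducts *%R 1).
have pr_s : all (fun P => monic_irr P && (P %| t)) (irr_divs t).
  by apply/allP => P; rewrite mem_irr_divs.
have dv1 (P : {poly F}) : monic_irr P && (P %| t) -> ~~ (P %| 1).
  by move=> /andP[/monic_irrP[_ [sP _]] _]; rewrite dvdp1 gtn_eqF.
have dvM (P x y : {poly F}) : monic_irr P && (P %| t) -> P %| x * y ->
    (P %| x) || (P %| y).
  case/andP=> /monic_irrP[_ iP] _ Pxy; rewrite -[_ || _]negbK negb_or.
  apply/negP => /andP[Px]; rewrite -irreducible_poly_coprime // => cPy.
  by move: Pxy; rewrite Gauss_dvdpl // (negPf Px).
have dvP (P Q : {poly F}) : monic_irr P && (P %| t) ->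
    monic_irr Q && (Q %| t) -> P %| Q -> P = Q.
  move=> /andP[iP _] /andP[iQ _] PQ; apply/eqP; apply: contraTT PQ => PQ.
  rewrite -irreducible_poly_coprime ?monic_irr_coprime //.
  by case/monic_irrP: iP.
have inj (P : {poly F}) : monic_irr P && (P %| t) -> injective ( *%R P).
  by move=> /andP[/monic_irrP[_ iP] _]; apply/mulfI/irredp_neq0.
have good x : x \in subproducts *%R 1 (irr_divs t) ->
    [/\ x \is monic, squarefree_poly x & x %| t].
  move: x; apply: (subproducts_ind dv1 dvM dvP _ _ pr_s (irr_divs_uniq t)).
    split; rewrite ?monic1 ?dvd1p // => u; rewrite dvdp1 => /eqP u2.
    have u0 : u != 0 by apply/eqP => u0; rewrite u0 expr0n size_poly0 in u2.
    move/(congr1 predn): u2; rewrite size_exp; move: u0; rewrite -size_poly_gt0.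
    by case: (size u) => [//|[//|m]].
  move=> P x /andP[/monic_irrP[mP iP] Pt] Px [mx sqf_x xt]; split.
  - by rewrite monicMr.
  - move=> u u2; case: (boolP (P %| u)) => Pu.
      have : P * P %| P * x by apply: dvdp_trans u2; rewrite expr2 dvdp_mul.
      by rewrite dvdp_mul2l ?irredp_neq0 // (negPf Px).
    apply: sqf_x; rewrite Gauss_dvdpr // in u2.
    by rewrite coprimep_expl // coprimep_sym irreducible_poly_coprime.
  by rewrite Gauss_dvdp ?Pt // irreducible_poly_coprime.
rewrite /W_poly cardE -[leqRHS](size_map val); apply: uniq_leq_size.
  apply: (subproducts_uniq dv1 dvM _ dvP inj pr_s (irr_divs_uniq t)).
  by move=> P x; apply: dvdp_mulr.
move=> x /good[mx sqf_x xt]; have sx : (size x <= size t)%N by apply: dvdp_leq.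
apply/mapP; exists (NPoly (n := size t) sx) => //.
by rewrite mem_enum inE /= mx xt; apply/asboolP.
Qed.

(** * The sieve *)

Section SieveFunctions.

Variables (T : finType) (J : eqType) (m : J -> T -> T).

Lemma img_ind_ge0 j x : 0 <= img_ind m j x.
Proof. exact: ler0n. Qed.

Lemma avoid_ge0 S x : 0 <= avoid m S x.
Proof. by rewrite avoidE ler0n. Qed.

Lemma avoid_le1 S x : avoid m S x <= 1.
Proof. by rewrite avoidE lern1 leq_b1. Qed.

Lemma avoid_cat S S' x : avoid m (S ++ S') x = avoid m S x * avoid m S' x.
Proof. exact: big_cat. Qed.

Lemma avoid_perm S S' x : perm_eq S S' -> avoid m S x = avoid m S' x.
Proof. exact: perm_big. Qed.

Lemma avoid_union_bound S x : 1 - \sum_(j <- S) img_ind m j x <= avoid m S x.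
Proof.
elim: S => [|j S IHS]; first by rewrite /avoid !big_nil subr0.
rewrite -cat1s avoid_cat big_cons {1}/avoid big_seq1 /img_ind.
case: [exists y, _]; last by rewrite add0r subr0 mul1r.
rewrite subrr mul0r opprD addNKr oppr_le0.
by apply: sumr_ge0 => i _; apply: img_ind_ge0.
Qed.

End SieveFunctions.

(** One minus the sum of the inverses of [c]; with [c] the list of all sieving
    moduli (primes [p] and norms [q ^ deg P]) this is the quantity delta. *)
Definition sieve_delta (R : numFieldType) (c : seq nat) : R :=
  1 - \sum_(i <- c) (i%:R)^-1.

(** The total weight of the error terms created by the sieving moduli [c]. *)
Definition sieve_mass (R : numFieldType) (c : seq nat) : R :=
  \sum_(i <- c) (1 - (i%:R)^-1).

Section Sieve.

Variables (F : finFieldType) (L : fieldExtType F).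
Let K : finFieldType := finvect_type L.
Let q := #|F|.
Let n := \dim {:L}.
Hypothesis n0 : (0 < n)%N.
Let M : {poly F} := 'X^n - 1.
Let N := #|K|.-1.
Let kap (P : {poly F}) : nat := (q ^ (size P).-1)%N.
Let root_card : algC := sqrtC #|K|%:R.

Variables (f f' : {poly F}) (r : nat).
Hypothesis ff' : f * f' = M.
Hypothesis r0 : (0 < r)%N.

Local Notation amap := (@act_map F L).
Local Notation pmap := (@pow_map K).

(** The sum of [G] over the pairs [(a, b)] with [a] nonzero and
    [a ^+ r] equal to the action of [f] on [b]. *)
Definition pair_sum (G : K -> K -> algC) : algC :=
  \sum_(a : K | a != 0) \sum_(b : K | amap f b == a ^+ r) G a b.

Lemma pair_sumE u Y :
  pair_sum (fun a b => u a * Y b) =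
  \sum_(a : K | a != 0) u a * push f Y (a ^+ r).
Proof. by apply: eq_bigr => a _; rewrite /push mulr_sumr. Qed.

Lemma pair_sum_real G : (forall a b, G a b \is Num.real) ->
  pair_sum G \is Num.real.
Proof. by move=> realG; apply: rpred_sum => a _; apply: rpred_sum. Qed.

Lemma ler_pair_sum G H : (forall a b, G a b <= H a b) ->
  pair_sum G <= pair_sum H.
Proof. by move=> le; apply: ler_sum => a _; apply: ler_sum. Qed.

Lemma sum_push Y : \sum_x push f Y x = \sum_(b : K) Y b.
Proof. by rewrite [RHS](partition_big (amap f) predT). Qed.

(** [S] consists of distinct primes dividing the order of the multiplicative
    group. *)
Definition prime_list (S : seq nat) : Prop :=
  uniq S /\ forall p, p \in S -> prime p && (p %| N)%N.

(** [T] consists of distinct monic irreducible divisors of ['X^n - 1]. *)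
Definition irr_list (T : seq {poly F}) : Prop :=
  uniq T /\ forall P, P \in T -> monic_irr P && (P %| M).

Local Notation dens S := (\prod_(p <- S) (1 - (p%:R)^-1) : algC).
Local Notation pdens T := (\prod_(P <- T) (1 - ((kap P)%:R)^-1) : algC).
Local Notation good := (fun P : {poly F} => P %| f').

Section Estimates.

Variables (S : seq nat) (T : seq {poly F}).
Hypotheses (SP : prime_list S) (TP : irr_list T).

Lemma sum_avoid_primes :
  \sum_(a : K | a != 0) avoid pmap S a = N%:R * dens S.
Proof.
case: SP => uS pS; rewrite (sum_avoid (D := predC1 0) (kappa := id)) //.
- by rewrite cardC1.
- by move=> p /pS /andP[/prime_gt0 p0 pN]; apply: regular_pow_map.
move=> p p' /pS /andP[p_pr _] /pS /andP[p'_pr _] pp'.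
apply: preserves_pow_map; rewrite ?prime_gt0 // prime_coprime //.
by rewrite dvdn_prime2 // eq_sym.
Qed.

Lemma sum_avoid_polys : \sum_(b : K) avoid amap T b = #|K|%:R * pdens T.
Proof.
case: TP => uT pT; rewrite (sum_avoid (D := predT) (kappa := kap)) //.
  by move=> P /pT /andP[_ PM]; apply: regular_act_map.
move=> P P' /pT /andP[iP _] /pT /andP[iP' _] PP'.
by apply: preserves_act_map; apply: monic_irr_coprime; rewrite // eq_sym.
Qed.

Lemma avoid_primes_fourier_le eta :
  {in predC1 (0 : K) &, {morph eta : x y / x * y}} ->
  (forall x : K, x != 0 -> eta x ^+ #|K|.-1 = 1) ->
  (forall p (x : K), (0 < p)%N -> (p %| #|K|.-1)%N -> x != 0 ->
    (eta x ^+ (#|K|.-1 %/ p) == 1) = [exists y, y ^+ p == x]) ->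
  mult_fourier_le eta (avoid pmap S) (2%:R ^+ size S * dens S).
Proof.
move=> etaM etaN eta_pow; case: SP => uS pS.
have -> : 2%:R ^+ size S * dens S = \prod_(p <- S) (2%:R * (1 - (p%:R)^-1)).
  by rewrite big_split /= big_const_seq iter_mulr_1 count_predT.
apply: fourier_le_prod => [i j x x0|x x0|p /pS /andP[/prime_gt0 p0 pN]].
- exact: exprD.
- exact: expr0.
exact: pow_free_fourier_le.
Qed.

Let wbound : algC := 2%:R ^+ size S * dens S.
Let ybound : algC := (kap f)%:R * 2%:R ^+ count good T * pdens T.

Lemma pair_sum_main_le :
  `|pair_sum (fun a b => avoid pmap S a * avoid amap T b)
     - pdens T * (N%:R * dens S)|
  <= wbound * (ybound - `|pdens T|) * (r%:R * root_card).
Proof.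
have [psi [psiD norm_psi psi1]] := exists_additive_character K.
have [eta [etaM norm_eta etaN eta_pow]] := exists_mult_character K.
rewrite pair_sumE -sum_avoid_primes.
apply: (correlation_le psiD norm_psi psi1 etaM norm_eta) => //.
- exact: avoid_primes_fourier_le.
- by case: TP => uT pT; apply: push_avoid_le.
by rewrite sum_push sum_avoid_polys.
Qed.

Lemma pair_sum_prime_le p : prime_list (p :: S) ->
  `|pair_sum (fun a b => avoid pmap S a * ((p%:R)^-1 - img_ind pmap p a)
                           * avoid amap T b)|
  <= (1 - (p%:R)^-1) * (wbound * ybound * (r%:R * root_card)).
Proof.
move=> [upS ppS].
have [psi [psiD norm_psi psi1]] := exists_additive_character K.
have [eta [etaM norm_eta etaN eta_pow]] := exists_mult_character K.
have /andP[p_pr pN] := ppS p (mem_head _ _).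
have p0 := prime_gt0 p_pr.
pose u a := avoid pmap S a * ((p%:R)^-1 - img_ind pmap p a).
have uB : mult_fourier_le eta u (wbound * (1 - (p%:R)^-1)).
  apply: fourier_leM => [i j x x0||]; first exact: exprD.
    exact: avoid_primes_fourier_le.
  exact: pow_ind_centered_fourier_le.
have u_sum : \sum_(a : K | a != 0) u a = 0.
  apply: (sum_avoid_centered (D := predC1 0) (kappa := id)).
    exact: regular_pow_map.
  move=> p' p'S; have /andP[p'_pr _] : prime p' && (p' %| N)%N.
    by apply: ppS; rewrite inE p'S orbT.
  apply: preserves_pow_map; rewrite ?prime_gt0 // prime_coprime //.
  rewrite dvdn_prime2 //; apply: contraTneq upS => ->.
  by rewrite /= p'S.
have YB : add_fourier_le psi (push f (avoid amap T)) ybound.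
  by case: TP => uT pT; apply: push_avoid_le.
have := correlation_le psiD norm_psi psi1 etaM norm_eta uB YB
  (b := pdens T) _ r0.
rewrite sum_push sum_avoid_polys u_sum mulr0 subr0 => /(_ erefl) le.
rewrite (pair_sumE u); apply: le_trans le _.
rewrite [leRHS]mulrA ler_wpM2r ?mulr_ge0 ?ler0n ?sqrtC_ge0 //.
rewrite [leRHS]mulrCA mulrA ler_wpM2l ?(fourier_le_ge0 uB) //.
by rewrite gerBl.
Qed.

Lemma pair_sum_poly_le P : irr_list (P :: T) ->
  `|pair_sum (fun a b => avoid pmap S a *
       (avoid amap T b * (((kap P)%:R)^-1 - img_ind amap P b)))|
  <= (good P)%:R * (1 - ((kap P)%:R)^-1) *
       (wbound * ybound * (r%:R * root_card)).
Proof.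
move=> [uPT pPT].
have [psi [psiD norm_psi psi1]] := exists_additive_character K.
have [eta [etaM norm_eta etaN eta_pow]] := exists_mult_character K.
have YB := push_avoid_centered_le n0 ff' psiD norm_psi psi1 uPT pPT.
have wB := avoid_primes_fourier_le etaM etaN eta_pow.
have := correlation_le psiD norm_psi psi1 etaM norm_eta wB YB (b := 0) _ r0.
rewrite sum_push (sum_avoid_centered (D := predT) (kappa := kap)); first last.
- move=> P' P'T; case: TP => _ pT; have /andP[iP' _] := pT _ P'T.
  have /andP[iP _] := pPT P (mem_head _ _).
  apply: preserves_act_map; apply: monic_irr_coprime => //.
  by apply: contraTneq uPT => ->; rewrite /= P'T.
- by apply: regular_act_map => //; case/andP: (pPT P (mem_head _ _)).
rewrite mulr0 => /(_ erefl); rewrite mul0r subr0 normr0 subr0.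
rewrite pair_sumE => le; apply: le_trans le _.
have rearrange (a b c d : algC) : a * (b * c) * d = b * (a * c * d) by ring.
by rewrite rearrange.
Qed.

End Estimates.

(** Starting from elements free with respect to [S0] and [T0], the moduli in
    [S1] and [T1] are removed by the union bound. Each is compared with its
    expected density, which leaves the main term multiplied by [delta] and one
    error term for every prime in [S1] and every [P] in [T1] dividing [f']. *)
Lemma sieve_positive (S0 S1 : seq nat) (T0 T1 : seq {poly F}) :
  prime_list (S0 ++ S1) -> irr_list (T0 ++ T1) ->
  let delta := sieve_delta algC (S1 ++ map kap T1) in
  let E := r%:R * 2%:R ^+ size S0 * 2%:R ^+ count good T0 * (kap f)%:R in
  0 < delta ->
  delta * E + E * sieve_mass algC (S1 ++ map kap (filter good T1))
    <= delta * root_card ->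
  0 < pair_sum (fun a b => avoid pmap (S0 ++ S1) a * avoid amap (T0 ++ T1) b).
Proof.
move=> [uS pS] [uT pT] delta E delta0 leE.
have S0P : prime_list S0.
  split=> [|p pS0]; first by move: uS; rewrite cat_uniq => /andP[].
  by apply: pS; rewrite mem_cat pS0.
have T0P : irr_list T0.
  split=> [|P PT0]; first by move: uT; rewrite cat_uniq => /andP[].
  by apply: pT; rewrite mem_cat PT0.
have S1P p : p \in S1 -> prime_list (p :: S0).
  move=> pS1; split=> /=; last first.
    move=> p'; rewrite inE => /orP[/eqP ->|p'S]; apply: pS.
      by rewrite mem_cat pS1 orbT.
    by rewrite mem_cat p'S.
  case: S0P => -> _; rewrite andbT; move: uS; rewrite cat_uniq.
  by case/and3P => _ /hasPn /(_ p pS1).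
have T1P P : P \in T1 -> irr_list (P :: T0).
  move=> PT1; split=> /=; last first.
    move=> P'; rewrite inE => /orP[/eqP ->|P'T]; apply: pT.
      by rewrite mem_cat PT1 orbT.
    by rewrite mem_cat P'T.
  case: T0P => -> _; rewrite andbT; move: uT; rewrite cat_uniq.
  by case/and3P => _ /hasPn /(_ P PT1).
pose w := avoid pmap S0; pose Y := avoid amap T0.
have realw a : w a \is Num.real by apply/ger0_real/avoid_ge0.
have realY b : Y b \is Num.real by apply/ger0_real/avoid_ge0.
have realVn (m : nat) : (m%:R^-1 : algC) \is Num.real.
  by rewrite realV realn.
have real_ind (J : eqType) (m : J -> K -> K) j x :
  img_ind m j x \is Num.real by apply/ger0_real/img_ind_ge0.
pose main := pair_sum (fun a b => w a * Y b).
pose corr_p p := pair_sum (fun a b =>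
  w a * ((p%:R)^-1 - img_ind pmap p a) * Y b).
pose corr_P P := pair_sum (fun a b =>
  w a * (Y b * (((kap P)%:R)^-1 - img_ind amap P b))).
have sieve_le :
    delta * main + (\sum_(p <- S1) corr_p p + \sum_(P <- T1) corr_P P)
    <= pair_sum (fun a b => avoid pmap (S0 ++ S1) a * avoid amap (T0 ++ T1) b).
  have -> :
      delta * main + (\sum_(p <- S1) corr_p p + \sum_(P <- T1) corr_P P) =
      pair_sum (fun a b => w a * Y b *
        (1 - \sum_(p <- S1) img_ind pmap p a
           - \sum_(P <- T1) img_ind amap P b)).
    rewrite mulr_sumr [\sum_(p <- S1) _]exchange_big.
    rewrite [\sum_(P <- T1) _]exchange_big.
    rewrite -!big_split; apply: eq_bigr => a _ /=.
    rewrite mulr_sumr [\sum_(p <- S1) _]exchange_big.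
    rewrite [\sum_(P <- T1) _]exchange_big.
    rewrite -!big_split; apply: eq_bigr => b _ /=.
    rewrite -mulr_suml -!mulr_sumr !sumrB /delta /sieve_delta.
    rewrite big_cat big_map /=.
    ring.
  apply: ler_pair_sum => a b; rewrite !avoid_cat mulrACA ler_wpM2l //.
    by rewrite mulr_ge0 ?avoid_ge0.
  have := avoid_union_bound pmap S1 a; have := avoid_union_bound amap T1 b.
  set A := avoid pmap S1 a; set B := avoid amap T1 b => leB leA.
  apply: (@le_trans _ _ (A + B - 1)).
    have := lerD leA leB; rewrite -(lerD2r (-1)); apply: le_trans.
    by rewrite le_eqVlt; apply/orP; left; apply/eqP; ring.
  (* The union bound for the two remaining conditions. *)
  rewrite -subr_ge0 (_ : A * B - _ = (1 - A) * (1 - B)); last by ring.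
  by rewrite mulr_ge0 // subr_ge0 avoid_le1.
apply: lt_le_trans sieve_le.
have dens_gt0 (c : seq nat) : (forall i, i \in c -> (1 < i)%N) ->
    0 < \prod_(i <- c) (1 - (i%:R)^-1) :> algC.
  move=> c1; rewrite big_seq; apply: prodr_gt0 => i /c1 i1.
  by rewrite subr_gt0 invf_lt1 ?ltr1n // ltr0n ltnW.
pose theta := dens S0; pose Theta := pdens T0.
have theta0 : 0 < theta.
  by apply: dens_gt0 => p; case: S0P => _ h /h /andP[/prime_gt1].
have Theta0 : 0 < Theta.
  rewrite /Theta -(big_map kap xpredT (fun i => 1 - (i%:R)^-1)).
  apply: dens_gt0 => _ /mapP[P PT ->]; case: T0P => _ /(_ P PT).
  case/andP=> /monic_irrP[_ [sP _]] _; rewrite /kap.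
  rewrite -{1}(expn0 q) ltn_exp2l ?card_field_gt1 //.
  by rewrite -ltnS prednK // ltnW.
pose C := theta * Theta * E * root_card.
have root0 : 0 < root_card.
  by rewrite sqrtC_gt0 ltr0n ltnW // finNzRing_gt1.
have root1 : 1 < root_card.
  by rewrite -sqrtC1 ltr_sqrtC ?qualifE /= ?ler01 ?ler0n // ltr1n finNzRing_gt1.
have mass_le : - (C * sieve_mass algC (S1 ++ map kap (filter good T1))) <=
    \sum_(p <- S1) corr_p p + \sum_(P <- T1) corr_P P.
  rewrite /sieve_mass big_cat big_map big_filter /= mulrDr opprD.
  rewrite !mulr_sumr -!sumrN.
  apply: lerD.
    rewrite big_seq [leRHS]big_seq; apply: ler_sum => p pS1.
    have := pair_sum_prime_le S0P T0P (S1P p pS1).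
    rewrite real_ler_norml; last first.
      apply: pair_sum_real => a b; rewrite rpredM ?realY // rpredM ?realw //.
      by rewrite rpredB ?realVn ?real_ind.
    case/andP => le _; apply: le_trans le; rewrite lerN2.
    rewrite le_eqVlt; apply/orP; left; apply/eqP.
    by rewrite /C /E /theta /Theta; ring.
  rewrite big_mkcond /= big_seq [leRHS]big_seq; apply: ler_sum => P PT1.
  have := pair_sum_poly_le S0P T0P (T1P P PT1).
  rewrite real_ler_norml; last first.
    apply: pair_sum_real => a b; rewrite rpredM ?realw // rpredM ?realY //.
    by rewrite rpredB ?realVn ?real_ind.
  case/andP => le _; apply: le_trans le; case: ifP => _; last first.
    by rewrite !mul0r oppr0.
  rewrite lerN2 le_eqVlt; apply/orP; left; apply/eqP.
  rewrite /C /E /theta /Theta.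
  rewrite (_ : true%:R = 1 :> algC) //; ring.
have main_le : theta * Theta * (root_card ^+ 2 - 1) -
    (C - theta * Theta * (2%:R ^+ size S0 * r%:R * root_card)) <= main.
  have := pair_sum_main_le S0P T0P; rewrite (gtr0_norm Theta0).
  rewrite real_ler_norml; last first.
    rewrite rpredB ?pair_sum_real // => [a b|].
      by rewrite rpredM ?realw ?realY.
    by apply: rpredM; [|apply: rpredM]; rewrite ?realn ?gtr0_real.
  case/andP => + _; rewrite -lerBlDr opprK addrC => le.
  apply: le_trans le; rewrite le_eqVlt; apply/orP; left; apply/eqP.
  have -> : N%:R = root_card ^+ 2 - 1.
    by rewrite sqrtCK /N -subn1 natrB // ltnW // finNzRing_gt1.
  rewrite /C /E -/theta -/Theta; ring.
have := lerD (ler_wpM2l (ltW delta0) main_le) mass_le.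
apply: lt_le_trans.
have -> : delta * (theta * Theta * (root_card ^+ 2 - 1) -
      (C - theta * Theta * (2%:R ^+ size S0 * r%:R * root_card))) -
    C * sieve_mass algC (S1 ++ map kap (filter good T1)) =
  theta * Theta * (root_card * (delta * root_card - (delta * E +
      E * sieve_mass algC (S1 ++ map kap (filter good T1)))) +
    delta * (2%:R ^+ size S0 * r%:R * root_card - 1)).
  rewrite /C; ring.
apply: mulr_gt0; first exact: mulr_gt0.
apply: ltr_wpDl; first by rewrite mulr_ge0 ?subr_ge0 // ltW.
apply: mulr_gt0 => //; rewrite subr_gt0.
apply: (lt_le_trans root1); apply: ler_peMl; first exact: ltW.
by rewrite -natrX -natrM ler1n muln_gt0 expn_gt0.
Qed.

End Sieve.

(** * Transfer between ordered fields *)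

Section RationalTransfer.

Lemma ratr_sieve_delta (R : numFieldType) c :
  ratr (sieve_delta rat c) = sieve_delta R c.
Proof.
rewrite /sieve_delta rmorphB rmorph1 rmorph_sum; congr (_ - _).
by apply: eq_bigr => i _; rewrite fmorphV rmorph_nat.
Qed.

Lemma ratr_sieve_mass (R : numFieldType) c :
  ratr (sieve_mass rat c) = sieve_mass R c.
Proof.
rewrite /sieve_mass rmorph_sum.
by apply: eq_bigr => i _; rewrite rmorphB rmorph1 fmorphV rmorph_nat.
Qed.

Lemma sieve_delta_gt0_transfer (R R' : numFieldType) c :
  0 < sieve_delta R c -> 0 < sieve_delta R' c.
Proof. by rewrite -(ratr_sieve_delta R) -(ratr_sieve_delta R') !ltr0q. Qed.

(** Squaring makes the bound rational, so it does not depend on the field. *)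
Lemma sieve_bound_transfer (R R' : numFieldType) c d E m :
  (sieve_delta R c * E%:R + E%:R * sieve_mass R d) ^+ 2
    <= sieve_delta R c ^+ 2 * m%:R ->
  (sieve_delta R' c * E%:R + E%:R * sieve_mass R' d) ^+ 2
    <= sieve_delta R' c ^+ 2 * m%:R.
Proof.
pose lhs : rat :=
  (sieve_delta rat c * E%:R + E%:R * sieve_mass rat d) ^+ 2.
pose rhs : rat := sieve_delta rat c ^+ 2 * m%:R.
have lhsE (R0 : numFieldType) : ratr lhs =
    (sieve_delta R0 c * E%:R + E%:R * sieve_mass R0 d) ^+ 2.
  rewrite /lhs rmorphXn rmorphD !rmorphM !rmorph_nat /=.
  by rewrite ratr_sieve_delta ratr_sieve_mass.
have rhsE (R0 : numFieldType) : ratr rhs = sieve_delta R0 c ^+ 2 * m%:R.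
  by rewrite /rhs rmorphM rmorphXn rmorph_nat /= ratr_sieve_delta.
by rewrite -(lhsE R) -(lhsE R') -(rhsE R) -(rhsE R') !ler_rat.
Qed.

Lemma sieve_mass_ge0 (R : numFieldType) c : (forall i, i \in c -> (0 < i)%N) ->
  0 <= sieve_mass R c.
Proof.
move=> c0; rewrite /sieve_mass big_seq; apply: sumr_ge0 => i /c0 i0.
by rewrite subr_ge0 invf_le1 ?ler1n ?ltr0n.
Qed.

End RationalTransfer.

Lemma N_count_pair_sum (F : finFieldType) (L : fieldExtType F) r f m
    (g : {poly F}) : (0 < m)%N -> g != 0 ->
  (N_count L r f m g)%:R = pair_sum (L := L) f r (fun a b =>
     avoid (@pow_map (finvect_type L)) (primes m) a *
     avoid (@act_map F L) (irr_divs g) b).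
Proof.
move=> m0 g0; rewrite /N_count natr_sum; apply: eq_bigr => a _.
rewrite natr_sum [RHS]big_mkcond; apply: eq_bigr => b _.
rewrite !natrM (w_avoid _ m0) (Omega_avoid _ g0) /I0_ind subr_eq0 eq_sym.
by rewrite /act_map; case: ifP => _; rewrite ?mulr1 ?mulr0.
Qed.

Theorem proposition3p5 (R : realType) (q n : nat) (F : finFieldType)
  (L : fieldExtType F)
  (hq : #|F| = q) (hn : (0 < n)%N) (hL : \dim {:L} = n)
  (r : nat) (hr : (r %| q ^ n - 1)%N)
  (k : nat) (f : {poly F}) (f_monic : f \is monic) (hf : f %| 'X^n - 1)
  (hk : (size f).-1 = k)
  (l : nat) (hl : (l %| q ^ n - 1)%N)
  (v : nat) (p : 'I_v -> nat) (p_inj : injective p)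
  (hp : forall t : nat, (exists i, p i = t) <->
     [/\ prime t, (t %| q ^ n - 1)%N & ~~ (t %| l)%N])
  (g : {poly F}) (g_monic : g \is monic) (hg : g %| 'X^n - 1)
  (s : nat) (P : 'I_s -> {poly F}) (P_inj : injective P)
  (hP : forall Q : {poly F}, (exists i, P i = Q) <->
     [/\ Q \is monic, irreducible_poly Q, Q %| 'X^n - 1 & ~~ (Q %| g)])
  (s' : nat) (hs' : (s' <= s)%N)
  (hPs' : forall i : 'I_s, (i < s')%N <-> P i %| ('X^n - 1) %/ f) :
  let deg (Q : {poly F}) := (size Q).-1 in
  let delta : R := 1 - \sum_(i < v) ((p i)%:R)^-1
                     - \sum_(i < s) (q%:R ^+ deg (P i))^-1 in
  let delta' : R := 1 - \sum_(i < s | (s' <= i)%N) (q%:R ^+ deg (P i))^-1 in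
  let Delta : R := 2 + (v%:R + s'%:R - delta') / delta in
  0 < delta ->
  r%:R * (W_nat l)%:R * (W_poly (gcdp g (('X^n - 1) %/ f)))%:R * Delta
    <= (q%:R : R) `^ (n%:R / 2 - k%:R) ->
  (0 < N_count L r f (q ^ n - 1) ('X^n - 1))%N.
Proof.
move=> deg delta delta' Delta delta_gt0 bound.
set M : {poly F} := 'X^n - 1 in hf hg hP hPs' bound *.
set f' := M %/ f in hPs' bound *; set N := (q ^ n - 1)%N in hr hl hp *.
have ff' : f * f' = M by rewrite mulrC divpK.
have q1 : (1 < q)%N by rewrite -hq; apply: card_field_gt1.
have qn1 : (1 < q ^ n)%N by rewrite -(expn0 q) ltn_exp2l.
have N0 : (0 < N)%N by rewrite subn_gt0.
have r0 : (0 < r)%N by apply: dvdn_gt0 hr.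
have l0 : (0 < l)%N by apply: dvdn_gt0 hl.
have n0 : (0 < \dim {:L})%N by rewrite hL.
have cardK : #|(finvect_type L : finFieldType)| = (q ^ n)%N.
  by rewrite card_finvect hq hL.
have M0 : M != 0 by rewrite -size_poly_eq0 size_XnsubC.
have g0 : g != 0 by apply: monic_neq0.
have f'0 : f' != 0 by apply: contraNneq M0 => f'0; rewrite -ff' f'0 mulr0.
pose kap (Q : {poly F}) := (#|F| ^ (size Q).-1)%N.
pose S0 := primes l; pose S1 := map p (index_enum 'I_v).
pose T0 := irr_divs g; pose T1 := map P (index_enum 'I_s).
have memS1 t : (t \in S1) = [&& prime t, (t %| N)%N & ~~ (t %| l)%N].
  apply/mapP/and3P => [[i _ ->]|/hp[i <-]]; last first.
    by exists i; rewrite ?mem_index_enum.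
  by apply/hp; exists i.
have memT1 Q : (Q \in T1) = [&& monic_irr Q, Q %| M & ~~ (Q %| g)].
  apply/mapP/and3P => [[i _ ->]|[/monic_irrP[mQ iQ] QM Qg]].
    have [mP iP PM Pg] : _ := (hP (P i)).1 (ex_intro _ i erefl).
    by split=> //; apply/monic_irrP.
  have [i <-] : _ := (hP Q).2 (And4 mQ iQ QM Qg).
  by exists i; rewrite ?mem_index_enum.
have permS : perm_eq (S0 ++ S1) (primes N).
  apply: uniq_perm; rewrite ?primes_uniq // ?cat_uniq ?primes_uniq /=.
    rewrite map_inj_uniq ?index_enum_uniq // andbT; apply/hasPn => t.
    by rewrite memS1 mem_primes => /and3P[_ _ /negPf ->]; rewrite !andbF.
  move=> t; rewrite mem_cat memS1 !mem_primes l0 N0 /=.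
  case: (prime t) => //=; case: (boolP (t %| l)%N) => [tl|_].
    by rewrite (dvdn_trans tl hl).
  by rewrite andbT.
have permT : perm_eq (T0 ++ T1) (irr_divs M).
  apply: uniq_perm; rewrite ?irr_divs_uniq // ?cat_uniq ?irr_divs_uniq /=.
    rewrite map_inj_uniq ?index_enum_uniq // andbT; apply/hasPn => Q.
    by rewrite memT1 mem_irr_divs // => /and3P[_ _ /negPf ->]; rewrite andbF.
  move=> Q; rewrite mem_cat memT1 !mem_irr_divs //.
  case: (monic_irr Q) => //=; case: (boolP (Q %| g)) => [Qg|_].
    by rewrite (dvdp_trans Qg hg).
  by rewrite andbT.
have SP : prime_list L (S0 ++ S1).
  split; first by rewrite (perm_uniq permS) primes_uniq.
  move=> t; rewrite (perm_mem permS) mem_primes cardK -subn1.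
  by case/and3P => -> _ ->.
have TP : irr_list L (T0 ++ T1).
  split; first by rewrite (perm_uniq permT) irr_divs_uniq.
  by move=> Q; rewrite (perm_mem permT) mem_irr_divs // hL.
pose c := S1 ++ map kap T1.
pose d := S1 ++ map kap (filter (fun Q => Q %| f') T1).
pose E := (r * 2 ^ size S0 * 2 ^ count (fun Q => (Q %| f')%R) T0 * kap f)%N.
have kap0 Q : (0 < kap Q)%N by rewrite expn_gt0 hq ltnW.
have d0 i : i \in d -> (0 < i)%N.
  rewrite mem_cat => /orP[|/mapP[Q _ ->]]; last exact: kap0.
  by rewrite memS1 => /and3P[/prime_gt0].
have kapE Q : (q%:R ^+ deg Q : R) = (kap Q)%:R by rewrite /kap hq natrX.
have deltaE : delta = sieve_delta R c.
  rewrite /sieve_delta big_cat big_map /= !big_map opprD addrA.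
  by congr (_ - _); apply: eq_bigr => i _; rewrite kapE.
(* [Delta] is one plus the error weight divided by [delta]: each of the [v]
   primes and [s'] polynomials contributes one minus its inverse modulus. *)
have massE : delta * Delta = delta + sieve_mass R d.
  have -> : sieve_mass R d = (v%:R - \sum_(i < v) ((p i)%:R)^-1) +
      (s'%:R - \sum_(i < s | (i < s')%N) (q%:R ^+ deg (P i))^-1).
    rewrite /sieve_mass /d big_cat !big_map big_filter big_map !sumrB.
    rewrite sumr_const card_ord; congr (_ + (_ - _)).
      transitivity (\sum_(i < s | (i < s')%N) (1 : R)).
        by apply: eq_bigl => i; apply/idP/idP => /hPs'.
      by rewrite -(big_ord_widen s (fun=> 1)) // sumr_const card_ord.
    apply: eq_big => [i|i _]; last by rewrite kapE.
    by apply/idP/idP => /hPs'.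
  have splitP : \sum_(i < s) (q%:R ^+ deg (P i))^-1 =
      \sum_(i < s | (i < s')%N) (q%:R ^+ deg (P i))^-1 +
      \sum_(i < s | (s' <= i)%N) (q%:R ^+ deg (P i))^-1 :> R.
    rewrite (bigID (fun i : 'I_s => (i < s')%N)); congr (_ + _).
    by apply: eq_bigl => i; rewrite -leqNgt.
  rewrite /Delta mulrDr [delta * (_ / _)]mulrC divfK ?gt_eqF //.
  rewrite /delta /delta' splitP; ring.
have boundR : (sieve_delta R c * E%:R + E%:R * sieve_mass R d) ^+ 2
    <= sieve_delta R c ^+ 2 * (q ^ n)%:R.
  have mass0 : 0 <= sieve_mass R d by apply: sieve_mass_ge0.
  have Delta0 : 0 <= Delta.
    rewrite -(pmulr_rge0 _ delta_gt0) massE addr_ge0 // ltW //.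
  have q0 : (0 : R) < q%:R by rewrite ltr0n ltnW.
  (* The square root of [q ^ n]. *)
  pose y : R := q%:R `^ (n%:R / 2).
  have y2 : y ^+ 2 = (q ^ n)%:R.
    by rewrite /y -powR_mulrn ?powR_ge0 // -powRrM divfK ?pnatr_eq0 //
      powR_mulrn ?ltW // natrX.
  have leE : E%:R * Delta <= y.
    have -> : y = (kap f)%:R * q%:R `^ (n%:R / 2 - k%:R).
      rewrite /kap hq hk natrX -powR_mulrn ?ltW // -powRD; last first.
        by rewrite (gt_eqF q0) implybT.
      by rewrite addrC subrK.
    apply: le_trans (ler_wpM2l (ler0n _ (kap f)) bound).
    rewrite -!natrM mulrA -natrM ler_wpM2r // ler_nat /E mulnC leq_mul2l.
    apply/orP; right; rewrite leq_mul ?leq_mul2l ?W_nat_ge ?orbT //.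
    have gf'0 : gcdp g f' != 0 by rewrite gcdp_eq0 negb_and g0.
    apply: leq_trans (W_poly_ge gf'0); rewrite leq_exp2l // -size_filter.
    apply: uniq_leq_size; first by rewrite filter_uniq ?irr_divs_uniq.
    move=> Q; rewrite mem_filter !mem_irr_divs // dvdp_gcd.
    by case/and3P => -> -> ->.
  rewrite -y2 -exprMn; rewrite -deltaE in mass0 *.
  have -> : delta * E%:R + E%:R * sieve_mass R d = delta * (E%:R * Delta).
    by rewrite mulrCA massE; ring.
  rewrite ler_pXn2r ?nnegrE ?mulr_ge0 ?ler0n ?powR_ge0 ?(ltW delta_gt0) //.
  by rewrite ler_wpM2l // ltW.
have boundC := sieve_bound_transfer algC boundR.
have deltaC : 0 < sieve_delta algC c.
  by apply: (sieve_delta_gt0_transfer (R := R)); rewrite -deltaE.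
rewrite -(ltr0n algC) N_count_pair_sum //.
rewrite (_ : pair_sum _ _ _ = pair_sum (L := L) f r (fun a b =>
    avoid (@pow_map (finvect_type L)) (S0 ++ S1) a *
    avoid (@act_map F L) (T0 ++ T1) b)); last first.
  apply: eq_bigr => a _; apply: eq_bigr => b _.
  by rewrite (avoid_perm _ _ permS) (avoid_perm _ _ permT).
apply: (sieve_positive (f' := f') n0 _ r0 SP TP) => //; first by rewrite hL.
have -> : r%:R * 2%:R ^+ size S0 * 2%:R ^+ count (fun Q => Q %| f') T0 *
    (#|F| ^ (size f).-1)%:R = E%:R :> algC.
  by rewrite /E !natrM !natrX.
rewrite -(@ler_pXn2r _ 2) ?nnegrE //.
- by rewrite [leRHS]exprMn sqrtCK cardK.
- by rewrite addr_ge0 ?mulr_ge0 ?ler0n ?sieve_mass_ge0 ?ltW.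
by rewrite mulr_ge0 ?sqrtC_ge0 ?ler0n ?ltW.
Qed.
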